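(* For every integer $\ell_0\ge2$ and all reals $p,\epsilon>0$ there exist $c_0>0$ and $n_0$ such that the following holds for all $n\ge n_0$. Let $2\le\ell\le\ell_0$, let $\kappa\in\mathbb{N}_+^\ell$ with $\kappa_1+\cdots+\kappa_\ell=n$ and $\kappa_i/n\ge p$ for all $i\in[\ell]$, and let $A\subseteq\mathcal{U}_\kappa$ with $\epsilon\le\mathrm{vol}(A)\le1-\epsilon$. Then either $$\mathbf{E}_{\kappa'\sim\mathbf{upper}(\kappa)}\bigl[\mathrm{vol}(\partial_{\kappa'}A)\bigr]\ \ge\ \mathrm{vol}(A)+c_0\,\frac{\log n}{n},$$ or else there exist $j\in[n]$ and colors $c\prec d$ in $[\ell]$ with $\mathrm{corr}_{j,c,d}[A]\ge1/n^{.01}$.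
   Context: For $\mu\in\mathbb{N}^\ell$ with $\sum_i\mu_i=n$, $\mathcal{U}_\mu=\{u\in[\ell]^n : u \text{ has exactly } \mu_i \text{ coordinates equal to } i,\ \forall i\in[\ell]\}$; for $B\subseteq\mathcal{U}_\mu$, $\mathrm{vol}(B)=|B|/|\mathcal{U}_\mu|$ (volume is relative to the containing multislice). Order colors $1\prec2\prec\cdots\prec\ell$, and extend to the coordinatewise partial order on $[\ell]^n$ ($u\prec v$ iff $u\ne v$ and $u_j\preceq v_j$ for all $j$). A histogram $\kappa'$ is an upper neighbor of $\kappa$ if for some colors $c\prec d$: $\kappa'_d=\kappa_d+1$, $\kappa'_c=\kappa_c-1$, and $\kappa'_i=\kappa_i$ for other $i$. The upper shadow of $A$ at an upper neighbor $\kappa'$ is $\partial_{\kappa'}A=\{u\in\mathcal{U}_{\kappa'} : v\prec u\text{ for some }v\in A\}$. The distribution $\mathbf{upper}(\kappa)$ on upper neighbors: take any $u\in\mathcal{U}_\kappa$; choose $j,j'\in[n]$ independently and uniformly, conditioned on $u_j\ne u_{j'}$; let $c\prec d$ be the two colors $u_j,u_{j'}$; output $\kappa'$ with $\kappa'_d=\kappa_d+1$, $\kappa'_c=\kappa_c-1$, other entries unchanged (the distribution does not depend on $u$). For $j\in[n]$ and colors $c\prec d$, $\mathrm{corr}_{j,c,d}[A]=\Pr_u[u\in A\mid u_j=d]-\Pr_u[u\in A\mid u_j=c]$, with $u$ uniform on $\mathcal{U}_\kappa$. *)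

(* Defs.v *)
From HB Require Import structures.
From mathcomp Require Import all_boot all_order all_algebra.
From mathcomp Require Import all_classical all_reals all_analysis.

Set Implicit Arguments.
Unset Strict Implicit.
Unset Printing Implicit Defensive.

Import Order.TTheory GRing.Theory Num.Theory.
Local Open Scope ring_scope.

(* Colors 1 < ... < l are the ordinals 'I_l = {0, ..., l-1} with their usual
   order, and coordinates j in [n] are ordinals 'I_n. *)
Notation string n l := {ffun 'I_n -> 'I_l}.
Notation histogram l := {ffun 'I_l -> nat}.

Definition multislice (n l : nat) (mu : histogram l) : {set string n l} :=
  [set u : string n l | [forall i, #|[set j | u j == i]%SET| == mu i]]%SET.

Definition vol (R : realType) (n l : nat) (mu : histogram l)
    (B : {set string n l}) : R :=
  #|B|%:R / #|multislice n mu|%:R.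

Definition string_prec (n l : nat) (u v : string n l) : bool :=
  (u != v) && [forall j, (u j <= v j)%N].

(* The truncated predecessor is only meaningful when 0 < kappa c. *)
Definition recolor (l : nat) (kappa : histogram l) (c d : 'I_l) : histogram l :=
  [ffun i => if i == d then (kappa d).+1
             else if i == c then (kappa c).-1 else kappa i].

Definition upper_neighbor (l : nat) (kappa kappa' : histogram l) : bool :=
  [exists c : 'I_l, exists d : 'I_l,
     [&& (c < d)%N, (0 < kappa c)%N & kappa' == recolor kappa c d]].

Definition upper_shadow (n l : nat) (kappa' : histogram l)
    (A : {set string n l}) : {set string n l} :=
  [set u in multislice n kappa' | [exists v in A, string_prec v u]]%SET.

Definition distinct_pairs (n l : nat) (u : string n l) : {set 'I_n * 'I_n} :=
  [set jj : 'I_n * 'I_n | u jj.1 != u jj.2]%SET.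

Definition upper_output (n l : nat) (kappa : histogram l) (u : string n l)
    (jj : 'I_n * 'I_n) : histogram l :=
  recolor kappa (Order.min (u jj.1) (u jj.2)) (Order.max (u jj.1) (u jj.2)).

Definition upper_from (R : realType) (n l : nat) (kappa : histogram l)
    (u : string n l) (kappa' : histogram l) : R :=
  #|[set jj in distinct_pairs u | upper_output kappa u jj == kappa']%SET|%:R
  / #|distinct_pairs u|%:R.

(* Probability mass function of upper(kappa); the choice of u is immaterial by
   upperE below, and the default value is used only when the multislice is
   empty. *)
Definition upper (R : realType) (n l : nat) (kappa kappa' : histogram l) : R :=
  if [pick u in multislice n kappa] is Some u then upper_from R kappa u kappa'
  else 0.

Definition expect_upper (R : realType) (n l : nat) (kappa : histogram l)
    (f : histogram l -> R) : R :=
  \sum_(kappa' \in [set k | upper_neighbor kappa k]%classic)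
     upper R n kappa kappa' * f kappa'.

Definition cond_prob (R : realType) (n l : nat) (kappa : histogram l)
    (E F : {set string n l}) : R :=
  #|multislice n kappa :&: F :&: E|%:R / #|multislice n kappa :&: F|%:R.

Definition corr (R : realType) (n l : nat) (kappa : histogram l)
    (A : {set string n l}) (j : 'I_n) (c d : 'I_l) : R :=
  cond_prob R kappa A [set u : string n l | u j == d]%SET
  - cond_prob R kappa A [set u : string n l | u j == c]%SET.

Lemma card_pairs_hist (n l : nat) (kappa : histogram l) (u : string n l)
    (P : 'I_l -> 'I_l -> bool) :
  u \in multislice n kappa ->
  #|[set jj : 'I_n * 'I_n | P (u jj.1) (u jj.2)]%SET|
  = (\sum_(c : 'I_l) \sum_(d : 'I_l | P c d) kappa c * kappa d)%N.
Proof.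
rewrite inE => /forallP hu.
rewrite -sum1dep_card (partition_big (fun jj => u jj.1) xpredT)//=.
apply: eq_bigr => c _.
rewrite (partition_big (fun jj => u jj.2) (P c)) /=; last first.
  by move=> jj /andP[+ /eqP <-].
apply: eq_bigr => d Pcd.
rewrite -(eqP (hu c)) -(eqP (hu d)) -cardsX -sum1_card.
apply: eq_bigl => -[j j'] /=; rewrite !inE /=.
case: eqP => [->|_]; case: eqP => [->|_]; rewrite ?andbF ?andbT //=.
Qed.

Lemma upper_fromE (R : realType) (n l : nat) (kappa kappa' : histogram l)
    (u v : string n l) :
  u \in multislice n kappa -> v \in multislice n kappa ->
  upper_from R kappa u kappa' = upper_from R kappa v kappa'.
Proof.
move=> hu hv; rewrite /upper_from /distinct_pairs.
pose P (c d : 'I_l) := c != d.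
pose Q (c d : 'I_l) :=
  (c != d) && (recolor kappa (Order.min c d) (Order.max c d) == kappa').
have E (w : string n l) : [set jj in [set jj : 'I_n * 'I_n | w jj.1 != w jj.2]%SET
               | upper_output kappa w jj == kappa']%SET
           = [set jj | Q (w jj.1) (w jj.2)]%SET :> {set 'I_n * 'I_n}.
  by apply/setP => jj; rewrite !inE.
by rewrite !E !(@card_pairs_hist _ _ kappa _ Q)// !(@card_pairs_hist _ _ kappa _ P).
Qed.

Lemma upperE (R : realType) (n l : nat) (kappa kappa' : histogram l)
    (u : string n l) :
  u \in multislice n kappa -> upper R n kappa kappa' = upper_from R kappa u kappa'.
Proof.
rewrite /upper => hu; case: pickP => [v hv|/(_ u)]; last by rewrite hu.
exact: upper_fromE.
Qed.

Lemma upper_output_neighbor (n l : nat) (kappa : histogram l) (u : string n l)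
    (jj : 'I_n * 'I_n) :
  u \in multislice n kappa -> jj \in distinct_pairs u ->
  upper_neighbor kappa (upper_output kappa u jj).
Proof.
rewrite !inE => /forallP hu; case: jj => j j' /= hj.
have kpos i : (0 < kappa (u i))%N.
  by rewrite -(eqP (hu (u i))); apply/card_gt0P; exists i; rewrite inE.
rewrite /upper_output /upper_neighbor /=.
apply/existsP; exists (Order.min (u j) (u j')).
apply/existsP; exists (Order.max (u j) (u j')).
rewrite eqxx andbT.
by case: ltgtP hj => [h _|h _|->]; rewrite ?eqxx // kpos andbT.
Qed.

Lemma expect_upperE (R : realType) (n l : nat) (kappa : histogram l)
    (f : histogram l -> R) (u : string n l) :
  u \in multislice n kappa ->
  expect_upper n kappa f
  = (\sum_(jj in distinct_pairs u) f (upper_output kappa u jj))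
    / #|distinct_pairs u|%:R.
Proof.
move=> hu; rewrite /expect_upper.
pose r := undup [seq upper_output kappa u jj | jj <- enum (distinct_pairs u)].
have inr jj : jj \in distinct_pairs u -> upper_output kappa u jj \in r.
  by move=> h; rewrite mem_undup; apply: map_f; rewrite mem_enum.
rewrite (fsbigE r) ?undup_uniq//; last first.
- move=> k _ kr; rewrite (upperE R k hu).
  rewrite /upper_from (_ : [set _ in _ | _]%SET = finset.set0) ?cards0 ?mul0r//.
  apply/setP => jj; rewrite !inE; apply/negP => /andP[h /eqP kE].
  by move/negP: kr; apply; rewrite -kE inr// inE.
- move=> k /=; rewrite mem_undup => /mapP[jj]; rewrite mem_enum => h ->.
  exact: upper_output_neighbor.
transitivity (\sum_(k <- r) upper_from R kappa u k * f k).
  rewrite big_seq_cond [RHS]big_seq; apply: eq_big => [k|k _]; last first.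
    by rewrite (upperE R k hu).
  case kr: (k \in r) => //=; apply/mem_set => /=.
  move: kr; rewrite mem_undup => /mapP[jj]; rewrite mem_enum => h ->.
  exact: upper_output_neighbor.
rewrite mulr_suml.
under eq_bigr => k _.
  rewrite /upper_from -sum1_card natr_sum mulrAC mulr_suml mulr_suml.
  under eq_bigl do rewrite inE.
  rewrite big_mkcondr /=.
  over.
rewrite exchange_big /=; apply: eq_bigr => jj hj.
rewrite (bigD1_seq (upper_output kappa u jj)) ?inr ?undup_uniq//= eqxx mul1r.
by rewrite big1 ?addr0// => k; rewrite eq_sym => /negbTE ->.
Qed.

(* Main.v *)
(* Two uniformly random lower neighbours, by the same pair of colors, of a
   random point of the slice kappa' differ by a transposition; hence the growth
   of the shadow is, up to constants, at least the average over transpositions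
   of the influence Pr[1_A(u) <> 1_A(u^(i j))].

   A KKL-type inequality makes this average at least c log n / n as soon as all
   influences are at most a negative power of n. It follows from the
   log-Sobolev inequality for transpositions on the multislice, proved by
   conditioning on one coordinate and induction on the number of coordinates:
   the generator L of the transposition walk W commutes with the derivatives
   D_ij f = f - f^(i j), so applying the inequality to all D_ij W^k f shows that
   the energy of W^k f decays at rate log(1 / max influence) / n, while its sum
   over k dominates the variance of f.

   It remains to bound the influences. If the expected growth of the shadow is
   O(log n / n), then for c < d and a fixed coordinate i the lower bound on the
   shadow restricted to u_i = d leaves, up to the correlation at (i, c, d),
   almost no room for strings that reach the shadow by raising another
   coordinate but not coordinate i; a pair u in A, u^(i j) notin A yields
   such a string. *)

Require Import Defs.
From HB Require Import structures.
From mathcomp Require Import all_boot all_order all_algebra.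
From mathcomp Require Import all_classical all_reals all_analysis.
From mathcomp Require Import all_fingroup ring lra zify.
(* Reimported so that set0, setT and subsetP are those of finite sets. *)
From mathcomp Require Import fintype finset.

Set Implicit Arguments.
Unset Strict Implicit.
Unset Printing Implicit Defensive.

Import Order.TTheory GRing.Theory Num.Theory.
Local Open Scope ring_scope.

(** * Entropy and variance inequalities for finite averages *)

(** The tangent bound [ln y <= y - 1] at [y = x / m]. The boundary case [x = 0] is separate because
    both sides carry the factor [x]. *)
Lemma mulr_ln_sub_le (R : realType) (x m : R) : 0 <= x -> 0 < m ->
  x * ln x - x * ln m <= x * (x / m - 1).
Proof.
rewrite le_eqVlt => /orP[/eqP <- _|x0 m0]; first by rewrite !mul0r subrr.
rewrite -mulrBr ler_pM2l// -ln_div ?posrE//.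
set y := x / m - 1; have -> : x / m = 1 + y by rewrite /y addrC subrK.
by apply: le_ln1Dx; rewrite /y ltrBrDl subrr divr_gt0.
Qed.

Lemma sum_weighted_variance (R : realType) (I : finType) (w x : I -> R) :
  \sum_i w i = 1 ->
  \sum_i \sum_j w i * w j * (x i - x j) ^+ 2 =
  2 * (\sum_i w i * x i ^+ 2 - (\sum_i w i * x i) ^+ 2).
Proof.
move=> w1.
transitivity (\sum_i \sum_j (w i * x i ^+ 2 * w j + w i * (w j * x j ^+ 2)
   - 2 * (w i * x i) * (w j * x j))).
  by apply: eq_bigr => i _; apply: eq_bigr => j _; ring.
transitivity (\sum_i (w i * x i ^+ 2 + w i * (\sum_j w j * x j ^+ 2)
   - 2 * (w i * x i) * (\sum_j w j * x j))).
  apply: eq_bigr => i _.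
  by rewrite sumrB big_split /= -!mulr_sumr w1 mulr1.
rewrite sumrB big_split /= -!mulr_suml w1 mul1r -mulr_sumr expr2.
ring.
Qed.

(** Since [0^-1 = 0], zero weights contribute nothing, and every positive weight satisfies
    [w i <= 1 <= (w i)^-1]. *)
Lemma sum_inv_weights_ge1 (R : realType) (I : finType) (w : I -> R) :
  (forall i, 0 <= w i) -> \sum_i w i = 1 -> 1 <= \sum_i (w i)^-1.
Proof.
move=> w0 w1; rewrite -[leLHS]w1; apply: ler_sum => i _.
have := w0 i; rewrite le_eqVlt => /orP[/eqP <-|wi]; first by rewrite invr0.
have wi1 : w i <= 1 by rewrite -w1 (bigD1 i)//= lerDl sumr_ge0.
by apply: (le_trans wi1); rewrite invf_ge1.
Qed.

(** Entropy is at most variance divided by the mean [m]. With [s], [t] the square roots of [x i],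
    [x j], the difference [x i - x j] is [(s - t) * (s + t)], and [x i <= P * m] on positive weights
    gives [(s + t) ^+ 2 <= 4 * P * m]. *)
Lemma weighted_entropy_le (R : realType) (I : finType) (w x : I -> R) :
  (forall i, 0 <= w i) -> (forall i, 0 <= x i) -> \sum_i w i = 1 ->
  \sum_i w i * (x i * ln (x i))
    - (\sum_i w i * x i) * ln (\sum_i w i * x i)
  <= 2 * (\sum_i (w i)^-1)
     * \sum_i \sum_j w i * w j * (Num.sqrt (x i) - Num.sqrt (x j)) ^+ 2.
Proof.
move=> w0 x0 w1; set m := \sum_i w i * x i; set P := \sum_i (w i)^-1.
have m_ge0 : 0 <= m by apply: sumr_ge0 => i _; rewrite mulr_ge0.
have S_ge0 : 0 <= \sum_i \sum_j
    w i * w j * (Num.sqrt (x i) - Num.sqrt (x j)) ^+ 2.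
  by do 2!(apply: sumr_ge0 => ? _); rewrite mulr_ge0 ?sqr_ge0 ?mulr_ge0.
have P1 : 1 <= P by exact: sum_inv_weights_ge1.
have [m0|mn0] := eqVneq m 0.
  rewrite m0 mul0r subr0 big1 => [|i _].
    by rewrite !mulr_ge0// (le_trans ler01 P1).
  have /eqP := m0; rewrite /m psumr_eq0 => [/allP /(_ i)|j _]; last by rewrite mulr_ge0.
  by rewrite mem_index_enum /= => /(_ isT) /eqP h; rewrite mulrA h mul0r.
have m_gt0 : 0 < m by rewrite lt_neqAle eq_sym mn0.
apply: (@le_trans _ _ ((\sum_i w i * x i ^+ 2 - m ^+ 2) / m)).
  have -> : m * ln m = \sum_i w i * x i * ln m by rewrite -mulr_suml.
  have -> : (\sum_i w i * x i ^+ 2 - m ^+ 2) / m =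
      \sum_i (w i * x i ^+ 2 / m - w i * x i).
    by rewrite sumrB -mulr_suml mulrBl expr2 mulfK.
  rewrite -sumrB; apply: ler_sum => i _.
  have -> : w i * x i ^+ 2 / m - w i * x i = w i * (x i * (x i / m - 1)) by ring.
  rewrite -mulrA -mulrBr ler_wpM2l//.
  exact: mulr_ln_sub_le.
rewrite ler_pdivrMr// -(ler_pM2l (x:=2))// -sum_weighted_variance//.
have -> : 2 * (2 * P * (\sum_i \sum_j w i * w j *
     (Num.sqrt (x i) - Num.sqrt (x j)) ^+ 2) * m) =
  \sum_i \sum_j (w i * w j * (Num.sqrt (x i) - Num.sqrt (x j)) ^+ 2) * (4 * P * m).
  under [RHS]eq_bigr do rewrite -mulr_suml.
  by rewrite -mulr_suml; ring.
have xP i : 0 < w i -> x i <= P * m.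
  move=> wi; apply: (@le_trans _ _ ((w i)^-1 * m)).
    rewrite ler_pdivlMl// /m (bigD1 i)//= lerDl sumr_ge0// => j _.
    by rewrite mulr_ge0.
  by rewrite ler_wpM2r// /P (bigD1 i)//= lerDl sumr_ge0// => j _; rewrite invr_ge0.
apply: ler_sum => i _; apply: ler_sum => j _.
have := w0 i; rewrite le_eqVlt => /orP[/eqP <-|wi]; first by rewrite !mul0r.
have := w0 j; rewrite le_eqVlt => /orP[/eqP <-|wj]; first by rewrite mulr0 !mul0r.
rewrite -[leRHS]mulrA ler_pM2l ?mulr_gt0//.
set s := Num.sqrt (x i); set t := Num.sqrt (x j).
have ss : x i = s ^+ 2 by rewrite sqr_sqrtr.
have tt : x j = t ^+ 2 by rewrite sqr_sqrtr.
have := xP i wi; have := xP j wj; rewrite ss tt => h1 h2.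
rewrite subr_sqr exprMn ler_wpM2l ?sqr_ge0//.
have := sqr_ge0 (s - t); nra.
Qed.

(** The variance is exactly half of the double sum; the larger constant gives the same shape as the
    entropy bound, so that one induction serves both. *)
Lemma weighted_variance_le (R : realType) (I : finType) (w x : I -> R) :
  (forall i, 0 <= w i) -> \sum_i w i = 1 ->
  \sum_i w i * x i ^+ 2 - (\sum_i w i * x i) ^+ 2
  <= 2 * (\sum_i (w i)^-1) * \sum_i \sum_j w i * w j * (x i - x j) ^+ 2.
Proof.
move=> w0 w1; have P1 := sum_inv_weights_ge1 w0 w1.
have S_ge0 : 0 <= \sum_i \sum_j w i * w j * (x i - x j) ^+ 2.
  by do 2!(apply: sumr_ge0 => ? _); rewrite mulr_ge0 ?sqr_ge0 ?mulr_ge0.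
have := sum_weighted_variance x w1; nra.
Qed.

(** Lagrange's identity: twice the difference of the two sides is a double sum of squares. *)
Lemma sum_cauchy_schwarz (R : realType) (I : finType) (P : {pred I}) (a b : I -> R) :
  (\sum_(i in P) a i * b i) ^+ 2 <=
  (\sum_(i in P) a i ^+ 2) * (\sum_(i in P) b i ^+ 2).
Proof.
rewrite -subr_ge0 -(pmulr_rge0 _ (x:=2))//.
have -> : 2 * ((\sum_(i in P) a i ^+ 2) * (\sum_(i in P) b i ^+ 2) -
    (\sum_(i in P) a i * b i) ^+ 2) =
  \sum_(i in P) \sum_(j in P) (a i * b j - a j * b i) ^+ 2.
  transitivity (\sum_(i in P) \sum_(j in P) (a i ^+ 2 * b j ^+ 2
    + b i ^+ 2 * a j ^+ 2 - 2 * (a i * b i) * (a j * b j))).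
    rewrite mulrBr mulr_natl mulr2n expr2.
    under [RHS]eq_bigr do rewrite sumrB big_split /= -!mulr_sumr.
    rewrite sumrB big_split /= -!mulr_suml -mulr_sumr; ring.
  by apply: eq_bigr => i _; apply: eq_bigr => j _; ring.
by do 2!(apply: sumr_ge0 => ? _); rewrite sqr_ge0.
Qed.

Lemma sqr_sum_le_card (R : realType) (I : finType) (P : {pred I}) (a : I -> R) :
  (\sum_(i in P) a i) ^+ 2 <= #|P|%:R * \sum_(i in P) a i ^+ 2.
Proof.
have := sum_cauchy_schwarz P (fun=> 1) a.
rewrite (eq_bigr a) => [|i _]; last by rewrite mul1r.
by rewrite expr1n sumr_const.
Qed.

Lemma mean_coupling_id (R : realType) (I : finType) (P : {set I}) (F G : I -> R) :
  #|P|%:R * ((\sum_(i in P) F i) / #|P|%:R - (\sum_(i in P) G i) / #|P|%:R) ^+ 2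
  <= \sum_(i in P) (F i - G i) ^+ 2.
Proof.
have [P0|P0] := posnP #|P|.
  by rewrite P0 mul0r sumr_ge0// => i _; rewrite sqr_ge0.
have N0 : 0 < #|P|%:R :> R by rewrite ltr0n.
rewrite -mulrBl -sumrB exprMn mulrCA [_^-1 ^+ 2]expr2 mulVKf ?gt_eqF//.
by rewrite ler_pdivrMr// mulrC sqr_sum_le_card.
Qed.

(** Joint convexity of the squared Hellinger distance: after expanding the squares only the cross
    terms differ, and Cauchy-Schwarz for the square roots of [F] and [G] compares them. *)
Lemma mean_coupling_sqrt (R : realType) (I : finType) (P : {set I}) (F G : I -> R) :
  (forall i, 0 <= F i) -> (forall i, 0 <= G i) ->
  #|P|%:R * (Num.sqrt ((\sum_(i in P) F i) / #|P|%:R)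
             - Num.sqrt ((\sum_(i in P) G i) / #|P|%:R)) ^+ 2
  <= \sum_(i in P) (Num.sqrt (F i) - Num.sqrt (G i)) ^+ 2.
Proof.
move=> F0 G0; have [P0|P0] := posnP #|P|.
  by rewrite P0 mul0r sumr_ge0// => i _; rewrite sqr_ge0.
have N0 : 0 < #|P|%:R :> R by rewrite ltr0n.
set N := #|P|%:R in N0 *; set SF := \sum_(i in P) F i; set SG := \sum_(i in P) G i.
have SF0 : 0 <= SF by apply: sumr_ge0.
have SG0 : 0 <= SG by apply: sumr_ge0.
have -> : \sum_(i in P) (Num.sqrt (F i) - Num.sqrt (G i)) ^+ 2 =
   SF + SG - 2 * \sum_(i in P) Num.sqrt (F i) * Num.sqrt (G i).
  rewrite mulr_sumr -big_split -sumrB; apply: eq_bigr => i _ /=.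
  by rewrite sqrrB !sqr_sqrtr//; ring.
have -> : N * (Num.sqrt (SF / N) - Num.sqrt (SG / N)) ^+ 2 =
   SF + SG - 2 * (Num.sqrt SF * Num.sqrt SG).
  rewrite sqrrB !sqr_sqrtr ?divr_ge0 ?(ltW N0)// !sqrtrM// !mulrDr.
  set r := Num.sqrt N^-1.
  have rN : r * r * N = 1.
    by rewrite -expr2 sqr_sqrtr ?invr_ge0 ?(ltW N0)// mulVf ?gt_eqF.
  rewrite ![N * (_ / N)]mulrC !divfK ?gt_eqF//.
  transitivity (SF + SG - 2 * (Num.sqrt SF * Num.sqrt SG) * (r * r * N));
    last by rewrite rN mulr1.
  ring.
rewrite lerD2l lerN2 ler_pM2l// -sqrtrM//.
set c := \sum_(i in P) _; have c0 : 0 <= c.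
  by apply: sumr_ge0 => i _; rewrite mulr_ge0 ?sqrtr_ge0.
rewrite -(ger0_norm c0) -sqrtr_sqr ler_sqrt ?mulr_ge0//.
apply: le_trans (sum_cauchy_schwarz _ _ _) _.
under eq_bigr do rewrite sqr_sqrtr//.
by under [X in _ * X]eq_bigr do rewrite sqr_sqrtr//.
Qed.

(** * Sobolev inequalities on slices *)

Definition swapc (n l : nat) (i j : 'I_n) (u : string n l) : string n l :=
  [ffun k => u (tperm i j k)].

Lemma swapcK (n l : nat) (i j : 'I_n) : involutive (@swapc n l i j).
Proof. by move=> u; apply/ffunP => k; rewrite !ffunE tpermK. Qed.

Lemma swapcC (n l : nat) (i j : 'I_n) (u : string n l) : swapc i j u = swapc j i u.
Proof. by rewrite /swapc tpermC. Qed.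

Lemma swapc1 (n l : nat) (i : 'I_n) (u : string n l) : swapc i i u = u.
Proof. by apply/ffunP => k; rewrite ffunE tperm1 perm1. Qed.

Lemma swapcL (n l : nat) (i j : 'I_n) (u : string n l) : swapc i j u i = u j.
Proof. by rewrite ffunE tpermL. Qed.

Lemma swapcR (n l : nat) (i j : 'I_n) (u : string n l) : swapc i j u j = u i.
Proof. by rewrite ffunE tpermR. Qed.

Definition hist (n l : nat) (S : {set 'I_n}) (u : string n l) (c : 'I_l) : nat :=
  #|[set k in S | u k == c]|.

Lemma hist_swapc (n l : nat) (S : {set 'I_n}) (i j : 'I_n) (u : string n l) c :
  i \in S -> j \in S -> hist S (swapc i j u) c = hist S u c.
Proof.
move=> iS jS; rewrite /hist -[RHS](card_imset _ (@perm_inj _ (tperm i j))).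
apply: eq_card => k; rewrite -[in RHS](tpermK i j k) mem_imset; last exact: perm_inj.
by rewrite !inE ffunE; case: tpermP => [->|->|//]; rewrite ?iS ?jS.
Qed.

Lemma hist_D1 (n l : nat) (S : {set 'I_n}) (i : 'I_n) (u : string n l) c :
  i \in S -> hist S u c = ((u i == c) + hist (S :\ i) u c)%N.
Proof.
move=> iS; rewrite /hist (cardsD1 i) inE iS /=; congr (_ + _)%N.
by apply: eq_card => k; rewrite !inE andbA.
Qed.

Lemma sum_hist (n l : nat) (S : {set 'I_n}) (u : string n l) :
  (\sum_c hist S u c)%N = #|S|.
Proof.
rewrite -[RHS]sum1_card (partition_big u xpredT)//=.
by apply: eq_bigr => c _; rewrite sum1dep_card.
Qed.

(** Coordinates outside [S] are frozen to those of [u0], so conditioning on a coordinate shrinks [S]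
    and keeps the type of strings. *)
Definition slice (n l : nat) (S : {set 'I_n}) (u0 : string n l) : {set string n l} :=
  [set u : string n l | [forall k, (k \notin S) ==> (u k == u0 k)]
    && [forall c, hist S u c == hist S u0 c]].

Lemma sliceP (n l : nat) (S : {set 'I_n}) (u0 u : string n l) :
  reflect ((forall k, k \notin S -> u k = u0 k) /\ hist S u =1 hist S u0)
    (u \in slice S u0).
Proof.
rewrite inE; apply: (iffP andP) => [[/forallP h1 /forallP h2]|[h1 h2]]; split.
- by move=> k kS; apply/eqP; move/implyP: (h1 k); apply.
- by move=> c; apply/eqP.
- by apply/forallP => k; apply/implyP => kS; rewrite h1.
- by apply/forallP => c; rewrite h2.
Qed.

Lemma slice_refl (n l : nat) (S : {set 'I_n}) (u0 : string n l) : u0 \in slice S u0.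
Proof. by apply/sliceP. Qed.

Lemma swapc_slice (n l : nat) (S : {set 'I_n}) (u0 u : string n l) i j :
  i \in S -> j \in S -> (swapc i j u \in slice S u0) = (u \in slice S u0).
Proof.
move=> iS jS.
have H v : v \in slice S u0 -> swapc i j v \in slice S u0.
  move=> /sliceP[h1 h2]; apply/sliceP; split=> [k kS|c].
    rewrite ffunE tpermD ?h1//; first by apply: contraNneq kS => <-.
    by apply: contraNneq kS => <-.
  by rewrite hist_swapc.
by apply/idP/idP => /H//; rewrite swapcK.
Qed.

(** This closure under conditioning on one coordinate is what the induction in [phi_sobolev] runs
    on. *)
Lemma slice_fiber (n l : nat) (S : {set 'I_n}) (u0 u1 : string n l) i :
  i \in S -> u1 \in slice S u0 ->
  [set u in slice S u0 | u i == u1 i] = slice (S :\ i) u1.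
Proof.
move=> iS /sliceP[h1 h2]; apply/setP => u; rewrite inE.
apply/andP/sliceP => [[/sliceP[e1 e2] /eqP ui]|[e1 e2]].
  split=> [k|c].
    by rewrite !inE negb_and negbK => /orP[/eqP ->//|kS]; rewrite e1// h1.
  by have := h2 c; rewrite -e2 !(@hist_D1 _ _ S i)// ui => /addnI.
have ui : u i = u1 i by rewrite e1// !inE eqxx.
split; last by rewrite ui.
apply/sliceP; split=> [k kS|c].
  by rewrite e1 ?h1// !inE negb_and kS orbT.
by rewrite -h2 !(@hist_D1 _ _ S i)// ui e2.
Qed.

Lemma card_slice_fiber (n l : nat) (S : {set 'I_n}) (u0 : string n l) i c d :
  i \in S -> c != d ->
  #|[set uj : string n l * 'I_n | [&& uj.1 \in slice S u0, uj.1 i == c,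
       uj.2 \in S & uj.1 uj.2 == d]]|
  = (hist S u0 d * #|[set u in slice S u0 | u i == c]|)%N.
Proof.
move=> iS cd; rewrite -[LHS]sum1dep_card.
rewrite (eq_bigl (fun uj => ((uj.1 \in slice S u0) && (uj.1 i == c)) &&
   ((uj.2 \in S) && (uj.1 uj.2 == d)))); last by move=> uj; rewrite -andbA.
rewrite -(pair_big_dep (fun u : string n l => (u \in slice S u0) && (u i == c))
  (fun (u : string n l) j => (j \in S) && (u j == d)) (fun _ _ => 1%N)) /=.
rewrite mulnC -sum_nat_const; apply: eq_big => [u|u /andP[/sliceP[_ h2] _]].
  by rewrite inE.
by rewrite sum1dep_card -h2.
Qed.

(* The pairs (eta, psi) in use are (x ln x, sqrt) and (x^2, id): phi_gap below is
   then an unnormalized entropy, respectively variance. *)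
Section PhiSobolev.
Variables (R : realType) (l : nat) (eta psi : R -> R).
Hypothesis eta_psi_weighted : forall w x : 'I_l -> R,
  (forall c, 0 <= w c) -> (forall c, 0 <= x c) -> \sum_c w c = 1 ->
  \sum_c w c * eta (x c) - eta (\sum_c w c * x c)
  <= 2 * (\sum_c (w c)^-1) * \sum_c \sum_d w c * w d * (psi (x c) - psi (x d)) ^+ 2.
Hypothesis psi_coupling : forall (I : finType) (P : {set I}) (F G : I -> R),
  (forall i, 0 <= F i) -> (forall i, 0 <= G i) ->
  #|P|%:R * (psi ((\sum_(i in P) F i) / #|P|%:R)
             - psi ((\sum_(i in P) G i) / #|P|%:R)) ^+ 2
  <= \sum_(i in P) (psi (F i) - psi (G i)) ^+ 2.
Variables (n : nat) (h : string n l -> R).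
Hypothesis h_ge0 : forall u, 0 <= h u.

Definition phi_gap (U : {set string n l}) : R :=
  \sum_(u in U) eta (h u) - #|U|%:R * eta ((\sum_(u in U) h u) / #|U|%:R).

Definition fiber (U : {set string n l}) i c : {set string n l} :=
  [set u in U | u i == c].

Definition fiber_mean U i c : R :=
  (\sum_(u in fiber U i c) h u) / #|fiber U i c|%:R.

(** The between-fiber part of [phi_gap]: what remains once [h] is replaced by its mean on each
    fiber. *)
Definition fiber_gap (U : {set string n l}) i : R :=
  \sum_c #|fiber U i c|%:R * eta (fiber_mean U i c)
  - #|U|%:R * eta ((\sum_(u in U) h u) / #|U|%:R).

Lemma sum_fiber (U : {set string n l}) i (F : string n l -> R) :
  \sum_c \sum_(u in fiber U i c) F u = \sum_(u in U) F u.
Proof.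
rewrite [RHS](partition_big (fun u : string n l => u i) xpredT)//=.
by apply: eq_bigr => c _; apply: eq_bigl => u; rewrite inE.
Qed.

(** Chain rule for entropy, respectively the law of total variance. *)
Lemma phi_gap_chain (U : {set string n l}) i :
  phi_gap U = \sum_c phi_gap (fiber U i c) + fiber_gap U i.
Proof.
by rewrite /phi_gap /fiber_gap sumrB sum_fiber addrA subrK.
Qed.

Lemma fiber_mean_ge0 U i c : 0 <= fiber_mean U i c.
Proof. by rewrite divr_ge0// sumr_ge0. Qed.

Definition swap_energy (S : {set 'I_n}) (u : string n l) : R :=
  \sum_(j in S) \sum_(k in S) (psi (h u) - psi (h (swapc j k u))) ^+ 2.

(* Coupling: u |-> u^(i j) exchanges the pairs (u, j) with u_i = c, u_j = d and
   those with u_i = d, u_j = c. *)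
Lemma fiber_pair_le (S : {set 'I_n}) u0 i c d : i \in S ->
  (hist S u0 d)%:R * #|fiber (slice S u0) i c|%:R *
    (psi (fiber_mean (slice S u0) i c) - psi (fiber_mean (slice S u0) i d)) ^+ 2
  <= \sum_(u in fiber (slice S u0) i c) \sum_(j in S | u j == d)
       (psi (h u) - psi (h (swapc i j u))) ^+ 2.
Proof.
move=> iS; set U := slice S u0.
have [->|cd] := eqVneq c d.
  rewrite subrr expr0n mulr0; do 2!(apply: sumr_ge0 => ? _).
  exact: sqr_ge0.
pose P a b := [set uj : string n l * 'I_n | [&& uj.1 \in U, uj.1 i == a,
       uj.2 \in S & uj.1 uj.2 == b]].
have cP : #|P c d|%:R = (hist S u0 d)%:R * #|fiber U i c|%:R :> R.
  by rewrite -natrM -card_slice_fiber.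
have sP (F : string n l -> 'I_n -> R) a b :
  \sum_(uj in P a b) F uj.1 uj.2
  = \sum_(u in fiber U i a) \sum_(j in S | u j == b) F u j.
  rewrite pair_big_dep; apply: eq_bigl => -[u j].
  by rewrite !inE /= andbA.
have sPf (F : string n l -> R) a b : \sum_(uj in P a b) F uj.1
    = (hist S u0 b)%:R * \sum_(u in fiber U i a) F u.
  rewrite (sP (fun u _ => F u)) mulr_sumr; apply: eq_bigr => u.
  rewrite inE => /andP[/sliceP[_ h2] _].
  by rewrite sumr_const mulr_natl -h2 /hist; congr (_ *+ _); apply: eq_card => k;
    rewrite !inE.
pose tau (uj : string n l * 'I_n) := (swapc i uj.2 uj.1, uj.2).
have tauK : involutive tau by move=> [u j]; rewrite /tau /= swapcK.
have tauP uj : (tau uj \in P d c) = (uj \in P c d).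
  case: uj => u j; rewrite [LHS]inE [RHS]inE /=; case jS: (j \in S); rewrite ?andbF//=.
  by rewrite /U swapc_slice// swapcL swapcR; do 2!case: eqP.
have sPtau F : \sum_(uj in P c d) F (tau uj) = \sum_(uj in P d c) F uj :> R.
  rewrite [RHS](reindex_inj (can_inj tauK)); apply: eq_bigl => uj.
  by rewrite tauP.
have cPP : #|P c d| = #|P d c|.
  by apply/eqP; rewrite -(eqr_nat R) -!sumr_const -(sPtau (fun=> 1)).
have [P0|P0] := posnP #|P c d|.
  rewrite -cP P0 mul0r; do 2!(apply: sumr_ge0 => ? _).
  exact: sqr_ge0.
(* Each string of the fiber lies in the same number of pairs, so its mean may be taken over the
   pairs instead. *)
have cancel a b : (0 < #|P a b|)%N -> #|P a b|%:R = (hist S u0 b)%:R * #|fiber U i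
  a|%:R :> R ->
   fiber_mean U i a = (\sum_(uj in P a b) h uj.1) / #|P a b|%:R.
  move=> Pab eab; rewrite sPf eab -mulf_div divff ?mul1r//.
  by apply: contraTneq Pab => e0; rewrite -(ltr_nat R) eab e0 mul0r ltxx.
rewrite (cancel c d)// (cancel d c) -?cPP//; last first.
  by rewrite cPP -natrM -card_slice_fiber// eq_sym.
rewrite -(sPtau (fun uj => h uj.1)) -cP.
apply: le_trans (psi_coupling _ _ _) _ => //.
by rewrite (sP (fun u j => (psi (h u) - psi (h (swapc i j u))) ^+ 2)).
Qed.

(** The exchange of [i] and [j] makes fiber sizes proportional to color counts; summing over the
    colors fixes the factor. Hence [u i] has law [hist S u0 c / #|S|]. *)
Lemma card_fiber (S : {set 'I_n}) u0 i c : i \in S ->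
  (#|fiber (slice S u0) i c| * #|S| = hist S u0 c * #|slice S u0|)%N.
Proof.
move=> iS; set U := slice S u0.
have sw a b : (hist S u0 b * #|fiber U i a| = hist S u0 a * #|fiber U i b|)%N.
  have [->//|ab] := eqVneq a b.
  rewrite -(card_slice_fiber u0 iS ab) -(card_slice_fiber u0 iS (c := b)) 1?eq_sym//.
  pose tau (uj : string n l * 'I_n) := (swapc i uj.2 uj.1, uj.2).
  have tauK : involutive tau by move=> [u j]; rewrite /tau /= swapcK.
  rewrite -[LHS](card_imset _ (can_inj tauK)); apply: eq_card => -[u j].
  rewrite -[(u, j)]tauK mem_imset; last exact: can_inj tauK.
  rewrite [LHS]inE [RHS]inE /=; case jS: (j \in S); rewrite ?andbF//= swapcK.
  by rewrite /U swapc_slice// swapcL swapcR; do 2!case: eqP.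
rewrite -(sum_hist S u0) big_distrr /=.
under eq_bigr => d _ do rewrite mulnC sw.
rewrite -big_distrr /=; congr (_ * _)%N.
rewrite -[RHS]sum1_card (partition_big (fun u : string n l => u i) xpredT)//=.
by apply: eq_bigr => d _; rewrite sum1dep_card.
Qed.

(** The weighted inequality is applied to the fiber means with the law of [u i] as weights;
    [fiber_pair_le] then bounds the term of each color pair by swaps with coordinate [i]. *)
Lemma fiber_gap_le (S : {set 'I_n}) u0 i : i \in S ->
  fiber_gap (slice S u0) i <=
  2 * (\sum_c ((hist S u0 c)%:R)^-1) *
  \sum_(u in slice S u0) \sum_(j in S) (psi (h u) - psi (h (swapc i j u))) ^+ 2.
Proof.
move=> iS; set U := slice S u0; set m := #|S|%:R : R.
have m0 : 0 < m by rewrite ltr0n; apply/card_gt0P; exists i.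
have U0 : 0 < #|U|%:R :> R by rewrite ltr0n; apply/card_gt0P; exists u0;
  exact: slice_refl.
pose w c : R := (hist S u0 c)%:R / m.
have wE c : #|fiber U i c|%:R = #|U|%:R * w c :> R.
  rewrite /w mulrA; apply: (canRL (mulfK _)); first by rewrite gt_eqF.
  by rewrite -!natrM card_fiber// mulnC.
have w_ge0 c : 0 <= w c by rewrite divr_ge0// ltW.
have w1 : \sum_c w c = 1.
  by rewrite -mulr_suml -natr_sum sum_hist divff// gt_eqF.
have mE : (\sum_(u in U) h u) / #|U|%:R = \sum_c w c * fiber_mean U i c.
  rewrite -(sum_fiber U i) mulr_suml; apply: eq_bigr => c _.
  have [f0|f0] := posnP #|fiber U i c|.
    rewrite /fiber_mean (cards0_eq f0) !big_set0 !mul0r mulr0//.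
  rewrite /fiber_mean wE invfM mulrCA.
  have w0 : w c != 0.
    by apply: contraTneq f0 => e0; rewrite -(ltr_nat R) wE e0 mulr0 ltxx.
  by rewrite [_^-1 / _]mulrC mulVKf.
rewrite /fiber_gap mE.
under eq_bigr do rewrite wE -mulrA.
rewrite -mulr_sumr -mulrBr.
have x0 c : 0 <= fiber_mean U i c by exact: fiber_mean_ge0.
apply: le_trans (ler_wpM2l (ltW U0) (eta_psi_weighted w_ge0 x0 w1)) _.
have -> : \sum_c (w c)^-1 = m * \sum_c ((hist S u0 c)%:R)^-1.
  by rewrite mulr_sumr; apply: eq_bigr => c _; rewrite /w invf_div.
set k := \sum_c ((hist S u0 c)%:R)^-1.
have k0 : 0 <= k by apply: sumr_ge0 => c _; rewrite invr_ge0.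
rewrite [leLHS](_ : _ = 2 * k * (\sum_c \sum_d m * (#|U|%:R * w c) * w d *
   (psi (fiber_mean U i c) - psi (fiber_mean U i d)) ^+ 2)); last first.
  transitivity (2 * k * (m * #|U|%:R * (\sum_c \sum_d w c * w d *
   (psi (fiber_mean U i c) - psi (fiber_mean U i d)) ^+ 2))); first by ring.
  congr (_ * _); rewrite mulr_sumr; apply: eq_bigr => c _.
  by rewrite mulr_sumr; apply: eq_bigr => d _; ring.
rewrite ler_wpM2l ?mulr_ge0// -(sum_fiber U i).
apply: ler_sum => c _.
rewrite [leRHS](_ : _ = \sum_d \sum_(u in fiber U i c) \sum_(j in S | u j == d)
       (psi (h u) - psi (h (swapc i j u))) ^+ 2); last first.
  rewrite [RHS]exchange_big /=; apply: eq_bigr => u _.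
  by rewrite (partition_big u xpredT).
apply: ler_sum => d _; apply: le_trans (fiber_pair_le u0 c d iS).
rewrite -wE /w -/U.
have -> // : forall x, m * #|fiber U i c|%:R * ((hist S u0 d)%:R / m) * x =
   (hist S u0 d)%:R * #|fiber U i c|%:R * x.
by move=> x; congr (_ * _); field; rewrite gt_eqF.
Qed.

(* The identity k (1/k - 1/(k+1)) = 1/(k+1) makes the sum of these weights over
   the conditioned coordinates contract, and 1/k <= 2/(k+1) pays for the
   one-coordinate term. *)
Definition sobolev_weight (S : {set 'I_n}) (u : string n l) : R :=
  4 * \sum_c ((hist S u c).+1%:R)^-1.

Lemma sum_sobolev_weight_D1 (S : {set 'I_n}) (u : string n l) j k :
  j != k -> j \in S -> k \in S ->
  \sum_(i in S :\: [set j; k]) sobolev_weight (S :\ i) u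
  <= (#|S|%:R - 1) * sobolev_weight S u.
Proof.
move=> jk jS kS; rewrite /sobolev_weight -mulr_sumr mulrCA ler_pM2l//.
rewrite exchange_big mulr_sumr /=; apply: ler_sum => c _.
set T := S :\: [set j; k]; set a := hist S u c.
have cT : #|S|%:R = #|T|%:R + 2 :> R.
  rewrite -(cardsID [set j; k] S) -/T (setIidPr _) ?cards2 ?jk.
    by rewrite addnC natrD.
  by apply/subsetP => x; rewrite !inE => /orP[]/eqP->.
have cTa : (#|[set i in T | u i == c]| <= a)%N.
  by apply: subset_leq_card; apply/subsetP => x; rewrite !inE => /andP[/andP[_ ->] ->].
(* Deleting a coordinate of color [c] raises the term from [1/(a+1)] to [1/a]; other deletions leave
   it alone. At most [a] deletions cost [1/(a(a+1))] each, in total at most [1/(a+1)]. *)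
rewrite (eq_bigr (fun i => (a.+1%:R : R)^-1 +
   (if u i == c then (a%:R)^-1 - (a.+1%:R : R)^-1 else 0))); last first.
  move=> i; rewrite inE => /andP[_ iS]; rewrite /a (hist_D1 _ _ iS).
  by case: eqP => _; rewrite ?addr0// addrC subrK.
rewrite big_split /= sumr_const -big_mkcondr /=.
rewrite (eq_bigl (mem [set i in T | u i == c])); last by move=> i; rewrite [RHS]inE.
rewrite sumr_const.
set t := #|[set i in T | u i == c]| in cTa *.
rewrite -[X in X + _ <= _]mulr_natl -[X in _ + X <= _]mulr_natl.
have -> : (#|S|%:R - 1 : R) = #|T|%:R + 1 by rewrite cT; ring.
rewrite mulrDl mul1r lerD2l.
have [a0|a0] := posnP a.
  by move: cTa; rewrite a0 leqn0 => /eqP ->; rewrite mul0r invr_ge0.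
have a0' : 0 < a%:R :> R by rewrite ltr0n.
have -> : (a%:R^-1 - a.+1%:R^-1 : R) = (a%:R)^-1 * (a.+1%:R)^-1.
  by rewrite -natr1; field; rewrite !gt_eqF// ltr_wpDl.
rewrite mulrA ler_piMl ?invr_ge0// ler_pdivrMr// mul1r ler_nat//.
Qed.

(** After exchanging the sums, the pair [(j, k)] survives in [S :\ i] exactly when [i] is neither
    [j] nor [k]. *)
Lemma sum_swap_energy_D1 (S : {set 'I_n}) (u : string n l) :
  \sum_(i in S) sobolev_weight (S :\ i) u * swap_energy (S :\ i) u
  <= (#|S|%:R - 1) * sobolev_weight S u * swap_energy S u.
Proof.
pose e j k := (psi (h u) - psi (h (swapc j k u))) ^+ 2.
have e0 j k : 0 <= e j k by exact: sqr_ge0.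
rewrite [leLHS](_ : _ = \sum_(j in S) \sum_(k in S)
   \sum_(i in S :\: [set j; k]) sobolev_weight (S :\ i) u * e j k); last first.
  transitivity (\sum_(i in S) \sum_(j in S) \sum_(k in S)
      if i \notin [set j; k] then sobolev_weight (S :\ i) u * e j k else 0).
    apply: eq_bigr => i iS; rewrite mulr_sumr.
    rewrite (eq_bigl (fun j => (j \in S) && (j != i))); last first.
      by move=> j; rewrite !inE andbC.
    rewrite big_mkcondr; apply: eq_bigr => j jS; case: (eqVneq j i) => ji /=.
      by rewrite big1// => k _; rewrite ji !inE eqxx.
    rewrite mulr_sumr (eq_bigl (fun j => (j \in S) && (j != i))); last first.
      by move=> k; rewrite !inE andbC.
    rewrite big_mkcondr; apply: eq_bigr => k kS.
    by rewrite !inE negb_or ![i == _]eq_sym ji.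
  rewrite exchange_big; apply: eq_bigr => j jS.
  rewrite exchange_big; apply: eq_bigr => k kS.
  by rewrite -big_mkcondr; apply: eq_bigl => i; rewrite !inE andbC.
rewrite /swap_energy mulr_sumr; apply: ler_sum => j jS.
rewrite mulr_sumr; apply: ler_sum => k kS.
rewrite -mulr_suml -/(e j k); have [->|jk] := eqVneq j k.
  by rewrite /e swapc1 subrr expr0n !mulr0.
by rewrite ler_wpM2r// sum_sobolev_weight_D1.
Qed.

Lemma phi_gap0 : phi_gap set0 = 0.
Proof. by rewrite /phi_gap big_set0 cards0 mul0r subrr. Qed.

(** Induction on [#|S|], with the chain rule averaged over all [i] in [S]. The fibers use up
    [#|S| - 1] copies of the weighted energy, and the between-fiber terms fit into the remaining
    one. *)
Lemma phi_sobolev (S : {set 'I_n}) (u0 : string n l) :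
  phi_gap (slice S u0) <=
  \sum_(u in slice S u0) sobolev_weight S u * swap_energy S u.
Proof.
move: {2}#|S| (erefl #|S|) => m; elim: m S u0 => [|m IH] S u0 cS.
  rewrite (cards0_eq cS) (_ : slice _ _ = [set u0]); last first.
    apply/setP => u; rewrite [RHS]inE; apply/sliceP/eqP => [[h1 _]|-> //].
    by apply/ffunP => k; rewrite h1// inE.
  rewrite /phi_gap cards1 !big_set1 divr1 mul1r subrr /swap_energy.
  by rewrite big_set0 mulr0.
set U := slice S u0.
have fiberE i c : i \in S -> phi_gap (fiber U i c) <=
    \sum_(u in fiber U i c) sobolev_weight (S :\ i) u * swap_energy (S :\ i) u.
  move=> iS; have [->|[u1 u1f]] := set_0Vmem (fiber U i c).
    by rewrite phi_gap0 big_set0.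
  have /andP[u1U /eqP u1i] : (u1 \in U) && (u1 i == c) by move: u1f; rewrite inE.
  rewrite (_ : fiber U i c = slice (S :\ i) u1) ?IH//.
    by move: cS; rewrite (cardsD1 i) iS => -[].
  by rewrite -(slice_fiber iS u1U) u1i.
have m0 : 0 < m.+1%:R :> R by rewrite ltr0n.
rewrite -(ler_pM2l m0) -[in leLHS]cS mulr_natl -sumr_const.
apply: (@le_trans _ _ (\sum_(i in S) (\sum_(u in U)
    sobolev_weight (S :\ i) u * swap_energy (S :\ i) u
  + 2 * (\sum_c ((hist S u0 c)%:R)^-1) *
  \sum_(u in U) \sum_(j in S) (psi (h u) - psi (h (swapc i j u))) ^+ 2))).
  apply: ler_sum => i iS; rewrite (phi_gap_chain _ i) lerD ?fiber_gap_le//.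
  by rewrite -(sum_fiber _ i); apply: ler_sum => c _; exact: fiberE.
rewrite big_split /= -mulr_sumr; set kk := 2 * \sum_c _.
rewrite exchange_big /= [X in _ * X]exchange_big /=.
rewrite !mulr_sumr -big_split /=; apply: ler_sum => u uU.
have E0 : 0 <= swap_energy S u.
  by do 2!(apply: sumr_ge0 => ? _); exact: sqr_ge0.
apply: (le_trans (lerD (sum_swap_energy_D1 S u) (lexx _))).
rewrite -/(swap_energy S u).
have -> : (#|S|%:R - 1 : R) = m%:R by rewrite cS -natr1 addrK.
have -> : m.+1%:R * (sobolev_weight S u * swap_energy S u) =
    m%:R * sobolev_weight S u * swap_energy S u
    + sobolev_weight S u * swap_energy S u by rewrite -natr1; ring.
rewrite lerD2l.
rewrite ler_wpM2r// /kk /sobolev_weight [4](_ : _ = 2 * 2); last by rewrite -natrM.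
rewrite -mulrA ler_pM2l// mulr_sumr; apply: ler_sum => c _.
have /sliceP[_ ->] := uU.
have [->|a0] := posnP (hist S u0 c); first by rewrite invr0 mulr_ge0// invr_ge0.
rewrite -[X in _ * X]invrK -/(_ / _) ler_pdivlMr ?invr_gt0 ?ltr0n//.
rewrite invrK mulrC ler_pdivrMr ?ltr0n// -natrM ler_nat. lia.
Qed.

End PhiSobolev.

(** * Energy decay along the transposition walk *)

Lemma swapc_conj (n l : nat) (i j a b : 'I_n) (u : string n l) :
  swapc i j (swapc a b u) =
  swapc a b (swapc (tperm a b i) (tperm a b j) u).
Proof.
apply/ffunP => k; rewrite !ffunE -[in RHS](tpermK a b k).
by rewrite -inj_tperm ?tpermK//; exact: perm_inj.
Qed.

Section SwapWalk.
Variables (R : realType) (n l : nat) (U : {set string n l}).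
Hypothesis n_gt0 : (0 < n)%N.
Hypothesis swapcU : forall i j u, (swapc i j u \in U) = (u \in U).
Implicit Types (t r : 'I_n * 'I_n) (f g : string n l -> R).

Let N : R := #|{: 'I_n * 'I_n}|%:R.

Lemma card_swaps_gt0 : 0 < N.
Proof. by rewrite ltr0n card_prod card_ord muln_gt0 n_gt0. Qed.

Definition dswap t g : string n l -> R := fun u => g u - g (swapc t.1 t.2 u).

Definition lap g : string n l -> R := fun u => \sum_t dswap t g u.

Definition ip f g : R := \sum_(u in U) f u * g u.

Definition energy f g : R := \sum_t ip (dswap t f) (dswap t g).

(** The lazy walk: hold with probability 1/2, otherwise swap a uniform ordered pair. Laziness makes
    the second-order term of the energy at most half of the first-order loss in [energy_walk_le]. *)
Definition walk g : string n l -> R := fun u => g u - lap g u / (2 * N).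

Lemma sum_swapc t (F : string n l -> R) :
  \sum_(u in U) F (swapc t.1 t.2 u) = \sum_(u in U) F u.
Proof.
rewrite [RHS](reindex_inj (can_inj (@swapcK n l t.1 t.2))).
by apply: eq_bigl => u; rewrite swapcU.
Qed.

Lemma ip_ge0 f : 0 <= ip f f.
Proof. by apply: sumr_ge0 => u _; rewrite -expr2 sqr_ge0. Qed.

Lemma energy_ge0 f : 0 <= energy f f.
Proof. by apply: sumr_ge0 => t _; exact: ip_ge0. Qed.

Lemma energyC f g : energy f g = energy g f.
Proof.
by apply: eq_bigr => t _; apply: eq_bigr => u _; rewrite mulrC.
Qed.

Lemma ip_lap f g : ip f (lap g) = \sum_t ip f (dswap t g).
Proof.
by rewrite /ip exchange_big; apply: eq_bigr => u _; rewrite mulr_sumr.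
Qed.

(** A transposition is a measure-preserving involution of [U], so [dswap t] is self-adjoint and its
    square is twice itself. *)
Lemma ip_dswap t f g : ip (dswap t f) (dswap t g) = 2 * ip f (dswap t g).
Proof.
rewrite /ip /dswap; set s := swapc t.1 t.2.
have e1 : \sum_(u in U) f (s u) * g (s u) = \sum_(u in U) f u * g u.
  exact: (sum_swapc t (fun u => f u * g u)).
have e2 : \sum_(u in U) f (s u) * g u = \sum_(u in U) f u * g (s u).
  rewrite -(sum_swapc t (fun u => f u * g (s u))).
  by apply: eq_bigr => u _; rewrite [s (swapc _ _ _)]swapcK.
transitivity (\sum_(u in U) f u * g u + \sum_(u in U) f (s u) * g (s u)
  - (\sum_(u in U) f (s u) * g u + \sum_(u in U) f u * g (s u))).
  by rewrite -!big_split -sumrB; apply: eq_bigr => u _ /=; ring.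
rewrite e1 e2 [in RHS](_ : \sum_(u in U) _ =
    \sum_(u in U) f u * g u - \sum_(u in U) f u * g (s u)); first by ring.
by rewrite -sumrB; apply: eq_bigr => u _; rewrite mulrBr.
Qed.

Lemma energyE f g : energy f g = 2 * ip f (lap g).
Proof. by rewrite ip_lap mulr_sumr; apply: eq_bigr => t _; rewrite ip_dswap. Qed.

(** Conjugation by [t] only permutes the transpositions summed in [lap]. *)
Lemma dswap_lap t g : dswap t (lap g) = lap (dswap t g).
Proof.
apply: funext => u; rewrite {1}/dswap /lap.
pose c r := (tperm t.1 t.2 r.1, tperm t.1 t.2 r.2).
have cK : involutive c by move=> [a b]; rewrite /c /= !tpermK.
rewrite [X in _ - X](reindex_inj (can_inj cK)) -sumrB.
apply: eq_bigr => -[a b] _; rewrite /dswap /= swapc_conj !tpermK; ring.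
Qed.

Lemma dswap_walk t g : dswap t (walk g) = walk (dswap t g).
Proof.
apply: funext => u; rewrite /walk -dswap_lap /dswap; ring.
Qed.

Lemma dswap_iter_walk t k g : dswap t (iter k walk g) = iter k walk (dswap t g).
Proof. by elim: k => //= k IH; rewrite dswap_walk IH. Qed.

Lemma ip_lap_le g : ip (lap g) (lap g) <= N * energy g g.
Proof.
rewrite /energy /ip exchange_big mulr_sumr; apply: ler_sum => u _.
rewrite -expr2; have := sqr_sum_le_card (fun _ : 'I_n * 'I_n => true) (fun t =>
  dswap t g u).
rewrite (eq_card (B := {: 'I_n * 'I_n}))//.
Qed.

Lemma energy_le g : energy g g <= 4 * N * ip g g.
Proof.
have -> : 4 * N * ip g g = \sum_(t : 'I_n * 'I_n) 4 * ip g g.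
  by rewrite sumr_const -mulr_natl; ring.
apply: ler_sum => t _.
have -> : 4 * ip g g = \sum_(u in U) (2 * g u ^+ 2 + 2 * g (swapc t.1 t.2 u) ^+ 2).
  rewrite big_split /= (sum_swapc t (fun u => 2 * g u ^+ 2)) -mulr_sumr /ip.
  under [in LHS]eq_bigr do rewrite -expr2.
  ring.
apply: ler_sum => u _; rewrite /dswap.
set x := g u; set y := g _; have := sqr_ge0 (x + y); nra.
Qed.

Lemma ipDl_sub (c : R) f g :
  ip (fun u => f u - c * g u) (fun u => f u - c * g u) =
  ip f f - 2 * c * ip f g + c ^+ 2 * ip g g.
Proof.
rewrite /ip !mulr_sumr -sumrB -big_split /=.
by apply: eq_bigr => u _; ring.
Qed.

Lemma walkE g : walk g = fun u => g u - (2 * N)^-1 * lap g u.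
Proof. by apply: funext => u; rewrite /walk mulrC. Qed.

Lemma ip_walk g : ip (walk g) (walk g) =
  ip g g - energy g g / (2 * N) + ip (lap g) (lap g) / (4 * N ^+ 2).
Proof.
have N0 : N != 0 by rewrite gt_eqF// card_swaps_gt0.
by rewrite walkE ipDl_sub energyE; field.
Qed.

Lemma ip_walk_ge g : ip g g - energy g g / (2 * N) <= ip (walk g) (walk g).
Proof.
by rewrite ip_walk lerDl divr_ge0 ?ip_ge0// mulr_ge0// sqr_ge0.
Qed.

Lemma ip_walk_le g : ip (walk g) (walk g) <= ip g g.
Proof.
have N0 := card_swaps_gt0; rewrite ip_walk.
have le1 : ip (lap g) (lap g) / (4 * N ^+ 2) <= energy g g / (4 * N).
  rewrite ler_pdivrMr; last by rewrite mulr_gt0// exprn_gt0.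
  apply: (le_trans (ip_lap_le g)); rewrite le_eqVlt; apply/orP; left.
  by apply/eqP; field; rewrite gt_eqF.
have le2 : energy g g / (4 * N) <= energy g g / (2 * N).
  rewrite ler_wpM2l ?energy_ge0// lef_pV2 ?posrE ?mulr_gt0// ler_pM2r//.
  by rewrite ler_nat.
lra.
Qed.

(** The linear term in the expansion of [g - lap g / (2 * N)] loses [2 / N] times the squared norm
    of [lap g]; [energy_le] bounds the quadratic term by half of that. *)
Lemma energy_walk_le g :
  energy (walk g) (walk g) <= energy g g - ip (lap g) (lap g) / N.
Proof.
have N0 := card_swaps_gt0.
have -> : energy (walk g) (walk g) = energy g g
   - 2 * (2 * N)^-1 * energy g (lap g) + (2 * N)^-1 ^+ 2 * energy (lap g) (lap g).
  rewrite /energy !mulr_sumr -sumrB -big_split; apply: eq_bigr => t _ /=.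
  by rewrite dswap_walk walkE -dswap_lap ipDl_sub.
have -> : energy g (lap g) = 2 * ip (lap g) (lap g) by rewrite energyC energyE.
have h := energy_le (lap g).
have c0 : 0 <= (2 * N)^-1 ^+ 2 by exact: sqr_ge0.
have := ler_wpM2l c0 h.
have -> : (2 * N)^-1 ^+ 2 * (4 * N * ip (lap g) (lap g)) = ip (lap g) (lap g) / N.
  by field; rewrite gt_eqF.
have -> : 2 * (2 * N)^-1 * (2 * ip (lap g) (lap g)) = 2 * (ip (lap g) (lap g) / N).
  by field; rewrite gt_eqF.
lra.
Qed.

Lemma sum_lap g : \sum_(u in U) lap g u = 0.
Proof.
rewrite exchange_big big1// => t _.
by rewrite sumrB sum_swapc subrr.
Qed.

Lemma sum_walk g : \sum_(u in U) walk g u = \sum_(u in U) g u.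
Proof. by rewrite sumrB -mulr_suml sum_lap mul0r subr0. Qed.

(** As an average over swaps, the walk preserves positivity and contracts the L1 norm. *)
Lemma walk_avg g u : walk g u = (2 * N)^-1 * \sum_t (g u + g (swapc t.1 t.2 u)).
Proof.
have N0 : N != 0 by rewrite gt_eqF// card_swaps_gt0.
rewrite /walk /lap sumrB big_split /= sumr_const -mulr_natl -/N.
by field.
Qed.

Lemma walk_ge0 g : (forall u, 0 <= g u) -> forall u, 0 <= walk g u.
Proof.
move=> g0 u; rewrite walk_avg mulr_ge0 ?invr_ge0 ?mulr_ge0 ?sumr_ge0//.
by move=> t _; rewrite addr_ge0.
Qed.

Lemma sum_norm_walk g : \sum_(u in U) `|walk g u| <= \sum_(u in U) `|g u|.
Proof.
rewrite -(sum_walk (fun u => `|g u|)); apply: ler_sum => u _.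
rewrite !walk_avg normrM ger0_norm ?invr_ge0 ?mulr_ge0//.
rewrite ler_wpM2l ?invr_ge0 ?mulr_ge0//.
apply: le_trans (ler_norm_sum _ _ _) _; apply: ler_sum => t _.
exact: ler_normD.
Qed.

Lemma sum_norm_iter_walk k g :
  \sum_(u in U) `|iter k walk g u| <= \sum_(u in U) `|g u|.
Proof. by elim: k => //= k; apply: le_trans; exact: sum_norm_walk. Qed.

Lemma ip_iter_walk_le k g : ip (iter k walk g) (iter k walk g) <= ip g g.
Proof. by elim: k => //= k; apply: le_trans; exact: ip_walk_le. Qed.

Definition entropy_sq g : R :=
  \sum_(u in U) g u ^+ 2 * ln (g u ^+ 2)
  - (\sum_(u in U) g u ^+ 2) * ln ((\sum_(u in U) g u ^+ 2) / #|U|%:R).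

(* ln (|g|/r) >= 1 - r/|g| bounds the first sum from below, and the mean of g^2
   is at most r^4. *)
Lemma entropy_sq_ge (g : string n l -> R) (r I : R) : 0 < r ->
  (0 < #|U|)%N -> I <= r ^+ 4 * #|U|%:R ->
  ip g g <= I -> \sum_(u in U) `|g u| <= I ->
  - 2 * ln r * ip g g - 2 * r * I <= entropy_sq g.
Proof.
move=> r0 U0 Ir gI g1; have U0' : 0 < #|U|%:R :> R by rewrite ltr0n.
have xE : \sum_(u in U) g u ^+ 2 = ip g g by apply: eq_bigr => u _; rewrite expr2.
rewrite /entropy_sq xE; set x := ip g g in gI *.
have le1 : 2 * x - 2 * r * I + 2 * ln r * x <= \sum_(u in U) g u ^+ 2 * ln (g u ^+ 2).
  apply: (@le_trans _ _ (\sum_(u in U)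
      (2 * g u ^+ 2 - 2 * r * `|g u| + 2 * ln r * g u ^+ 2))).
    rewrite big_split sumrB /= -!mulr_sumr xE lerD2r lerD2l lerN2.
    by rewrite ler_pM2l ?mulr_gt0.
  apply: ler_sum => u _; rewrite -!(real_normK (num_real (g u))).
  set y := `|g u|; have : 0 <= y by exact: normr_ge0.
  rewrite le_eqVlt => /orP[/eqP <-|y0].
    by rewrite expr0n /= mul0r !mulr0 subrr addr0.
  have -> : ln (y ^+ 2) = 2 * ln y by rewrite lnXn// mulr_natl.
  have : ln (r / y) <= r / y - 1.
    set z := r / y - 1; have -> : r / y = 1 + z by rewrite /z addrC subrK.
    by apply: le_ln1Dx; rewrite /z ltrBrDl subrr divr_gt0.
  rewrite ln_div ?posrE// => /(ler_wpM2l (sqr_ge0 y)).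
  have -> : y ^+ 2 * (r / y - 1) = r * y - y ^+ 2 by field; rewrite gt_eqF.
  lra.
have [x0|x0] := eqVneq x 0.
  by move: le1; rewrite x0 mul0r subr0 !mulr0; apply: le_trans; lra.
have {x0}x0 : 0 < x by rewrite lt_neqAle eq_sym x0 ip_ge0.
have le2 : x * ln (x / #|U|%:R) <= x * (4 * ln r).
  rewrite ler_pM2l//; have -> : 4 * ln r = ln (r ^+ 4) by rewrite lnXn// mulr_natl.
  rewrite ler_ln ?posrE ?divr_gt0 ?exprn_gt0//.
  by rewrite ler_pdivrMr//; apply: le_trans Ir.
lra.
Qed.

(** * Energy decay for a Boolean function with small influences *)

Variable a : R.
Hypothesis a_ge0 : 0 <= a.
Hypothesis U_gt0 : (0 < #|U|)%N.
Hypothesis logsobolev : forall g, entropy_sq g <= a * energy g g.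
Hypothesis poincare : forall g, (forall u, 0 <= g u) ->
  ip g g - (\sum_(u in U) g u) ^+ 2 / #|U|%:R <= a * energy g g.

Variables (f : string n l -> R) (r : R).
Hypothesis f01 : forall u, f u = 0 \/ f u = 1.
Hypothesis r_gt0 : 0 < r.
Hypothesis influence_le : forall t, ip (dswap t f) (dswap t f) <= r ^+ 4 * #|U|%:R.

Let fk k := iter k walk f.
Let e k := energy (fk k) (fk k).

(** The derivative takes values in {-1, 0, 1}. Hence one quantity, the influence, serves as [I] for
    both norms in [entropy_sq_ge]. *)
Lemma sum_norm_dswap01 t : \sum_(u in U) `|dswap t f u| = ip (dswap t f) (dswap t f).
Proof.
apply: eq_bigr => u _; rewrite /dswap.
case: (f01 u) => ->; case: (f01 (swapc t.1 t.2 u)) => ->;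
  rewrite ?subrr ?subr0 ?sub0r ?normrN ?normr0 ?normr1; ring.
Qed.

(** Log-Sobolev is applied to every derivative of [fk k], whose L1 and L2 norms the walk has not
    increased. Commutation turns the sum of the energies of the derivatives into four times the
    squared norm of [lap (fk k)], which the energy drop controls. *)
Lemma energy_decay k :
  - 2 * ln r * e k - 2 * r * e 0 <= 4 * a * N * (e k - e k.+1).
Proof.
have N0 := card_swaps_gt0.
apply: (@le_trans _ _ (\sum_t entropy_sq (dswap t (fk k)))).
  rewrite /e /energy !mulr_sumr -sumrB; apply: ler_sum => t _.
  rewrite /fk dswap_iter_walk /=; apply: entropy_sq_ge => //.
    exact: ip_iter_walk_le.
  by rewrite -sum_norm_dswap01 sum_norm_iter_walk.
apply: (@le_trans _ _ (4 * a * ip (lap (fk k)) (lap (fk k)))).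
  apply: (@le_trans _ _ (\sum_t a * energy (dswap t (fk k)) (dswap t (fk k)))).
    by apply: ler_sum => t _.
  rewrite -mulr_sumr.
  under eq_bigr do rewrite energyE -dswap_lap.
  rewrite -mulr_sumr -/(energy (fk k) (lap (fk k))) energyC energyE.
  by rewrite le_eqVlt; apply/orP; left; apply/eqP; ring.
have h := energy_walk_le (fk k).
rewrite -[leRHS]mulrA; apply: ler_wpM2l; first by rewrite mulr_ge0.
rewrite -ler_pdivrMl// mulrC /e /fk /= -/(fk k); move: h.
lra.
Qed.

Lemma sum_energy_le K :
  - 2 * ln r * (\sum_(k < K) e k) <= (2 * K%:R * r + 4 * a * N) * e 0.
Proof.
have N0 := card_swaps_gt0.
have : \sum_(k < K) (- 2 * ln r * e k - 2 * r * e 0) <=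
    \sum_(k < K) 4 * a * N * (e k - e k.+1).
  by apply: ler_sum => k _; exact: energy_decay.
rewrite sumrB -!mulr_sumr sumr_const card_ord -mulr_natr.
have -> : \sum_(k < K) (e k - e k.+1) = e 0 - e K.
  by rewrite -opprB -(telescope_sumr e (leq0n K)) -sumrN big_mkord;
    apply: eq_bigr => k _; rewrite opprB.
have : 0 <= 4 * a * N * e K by rewrite mulr_ge0 ?energy_ge0// mulr_ge0 ?(ltW N0)//
  mulr_ge0.
lra.
Qed.

(** Step [k] of the walk loses at most [e k / (2 * N)] of the squared norm and keeps the mean; the
    variance still present at time [k] is at most [a * e k] by Poincare. *)
Lemma sum_energy_ge K :
  K%:R * (ip f f - (\sum_(u in U) f u) ^+ 2 / #|U|%:R) <=
  (a + K%:R / (2 * N)) * \sum_(k < K) e k.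
Proof.
have N0 := card_swaps_gt0; set E := \sum_(k < K) e k.
have f0 u : 0 <= f u by case: (f01 u) => ->.
have e0 k : 0 <= e k by exact: energy_ge0.
have fk0 k : forall u, 0 <= fk k u by elim: k => //= k; exact: walk_ge0.
have sfk k : \sum_(u in U) fk k u = \sum_(u in U) f u.
  by elim: k => //= k IH; rewrite sum_walk.
have lower k : ip f f - (\sum_(i < k) e i) / (2 * N) <= ip (fk k) (fk k).
  elim: k => [|k IH]; first by rewrite big_ord0 mul0r subr0.
  rewrite big_ord_recr /= mulrDl; have := ip_walk_ge (fk k); rewrite -/(e k); lra.
have step (k : 'I_K) : ip f f - (\sum_(u in U) f u) ^+ 2 / #|U|%:R - E / (2 * N) <=
  a * e k.
  have := poincare (fk0 k); rewrite sfk; have := lower k.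
  have : (\sum_(i < k) e i) / (2 * N) <= E / (2 * N).
    rewrite ler_wpM2r ?invr_ge0 ?mulr_ge0 ?(ltW N0)// /E.
    rewrite (big_ord_widen K e (ltnW (ltn_ord k))) big_mkcond.
    by apply: ler_sum => i _; case: ifP.
  rewrite /e; lra.
have : \sum_(k < K) (ip f f - (\sum_(u in U) f u) ^+ 2 / #|U|%:R - E / (2 * N))
    <= \sum_(k < K) a * e k by apply: ler_sum => k _.
rewrite -mulr_sumr sumr_const card_ord -mulr_natl -/E.
have -> : (a + K%:R / (2 * N)) * E = a * E + K%:R * (E / (2 * N)) by ring.
lra.
Qed.

(** The two bounds on the summed energies are chained. The time horizon [K] stays free, to be taken
    proportional to [n]. *)
Lemma kkl_energy K : r <= 1 ->
  - 2 * ln r * (K%:R * (ip f f - (\sum_(u in U) f u) ^+ 2 / #|U|%:R)) <=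
  (a + K%:R / (2 * N)) * ((2 * K%:R * r + 4 * a * N) * energy f f).
Proof.
move=> r1; have N0 := card_swaps_gt0.
have L0 : 0 <= - 2 * ln r by rewrite mulNr -mulrN mulr_ge0// oppr_ge0 ln_le0.
apply: (le_trans (ler_wpM2l L0 (sum_energy_ge K))).
rewrite mulrCA ler_wpM2l ?addr_ge0 ?divr_ge0 ?mulr_ge0 ?(ltW N0)//.
exact: sum_energy_le.
Qed.

End SwapWalk.

(** * Shadows, transpositions and correlations *)

Lemma multisliceP (n l : nat) (mu : histogram l) (u : string n l) :
  reflect (hist setT u =1 mu) (u \in multislice n mu).
Proof.
rewrite inE; apply: (iffP forallP) => h c; have := h c.
  by move=> /eqP <-; apply: eq_card => k; rewrite !inE.
by move=> <-; apply/eqP; apply: eq_card => k; rewrite !inE.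
Qed.

Lemma slice_multislice (n l : nat) (mu : histogram l) (u0 : string n l) :
  u0 \in multislice n mu -> slice setT u0 = multislice n mu.
Proof.
move=> /multisliceP h0; apply/setP => u; apply/sliceP/multisliceP.
  by move=> [_ h] c; rewrite h h0.
by move=> h; split=> [k|c]; [rewrite inE|rewrite h h0].
Qed.

Lemma swapc_multislice (n l : nat) (mu : histogram l) (u : string n l) i j :
  (swapc i j u \in multislice n mu) = (u \in multislice n mu).
Proof.
by apply/multisliceP/multisliceP => h c; rewrite -h hist_swapc ?inE.
Qed.

Lemma card_multislice_fiber (n l : nat) (mu : histogram l) i (c : 'I_l) :
  (#|[set u in multislice n mu | u i == c]| * n = mu c * #|multislice n mu|)%N.
Proof.
have [->|[u0 u0U]] := set_0Vmem (multislice n mu).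
  rewrite cards0 muln0; apply/eqP; rewrite muln_eq0; apply/orP; left.
  by rewrite cards_eq0; apply/eqP/setP => u; rewrite !inE.
have := card_fiber u0 c (in_setT i); rewrite (slice_multislice u0U) cardsT card_ord.
by move/multisliceP: u0U => ->.
Qed.

Lemma energy_swap_energy (R : realType) (n l : nat) (U : {set string n l})
    (psi : R -> R) (h : string n l -> R) :
  \sum_(u in U) swap_energy psi h setT u
  = energy U (fun u => psi (h u)) (fun u => psi (h u)).
Proof.
rewrite /swap_energy /energy /ip /dswap [RHS]exchange_big; apply: eq_bigr => u _.
rewrite pair_big /=; apply: eq_big => [t|t _]; first by rewrite !inE.
by rewrite expr2.
Qed.

(** The instance [x ^+ 2], [id] of [phi_sobolev] with all coordinates in [S], where the Sobolev
    weight is constant on the multislice. *)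
Lemma multislice_poincare (R : realType) (n l : nat) (mu : histogram l) (a : R)
    (g : string n l -> R) :
  4 * \sum_c ((mu c).+1%:R)^-1 <= a -> (forall u, 0 <= g u) ->
  ip (multislice n mu) g g
    - (\sum_(u in multislice n mu) g u) ^+ 2 / #|multislice n mu|%:R
  <= a * energy (multislice n mu) g g.
Proof.
move=> ha g0; have [->|[u0 u0U]] := set_0Vmem (multislice n mu).
  rewrite /ip /energy !big_set0 expr0n /= mul0r subrr big1 ?mulr0// => t _.
  by rewrite /ip big_set0.
have := @phi_sobolev R l (fun x => x ^+ 2) id
  (fun w x w0 _ w1 => weighted_variance_le x w0 w1)
  (fun I P F G _ _ => mean_coupling_id P F G) n g g0 setT u0.
rewrite (slice_multislice u0U) /phi_gap.
under [X in _ <= X]eq_bigr => u /multisliceP uU.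
  rewrite (_ : sobolev_weight R setT u = 4 * \sum_c ((mu c).+1%:R)^-1); last first.
    by congr (_ * _); apply: eq_bigr => c _; rewrite uU.
  over.
rewrite -mulr_sumr energy_swap_energy => h.
apply: le_trans (ler_wpM2r (energy_ge0 _ _) ha); apply: le_trans h.
rewrite /ip; under eq_bigr do rewrite -expr2.
have U0 : #|multislice n mu|%:R != 0 :> R.
  by rewrite pnatr_eq0 -lt0n; apply/card_gt0P; exists u0.
by rewrite le_eqVlt; apply/orP; left; apply/eqP; field.
Qed.

(** The instance [x * ln x], [Num.sqrt] applied to [g ^+ 2]. It yields the energy of the absolute
    value of [g], which is at most that of [g]. *)
Lemma multislice_logsobolev (R : realType) (n l : nat) (mu : histogram l) (a : R)
    (g : string n l -> R) :
  4 * \sum_c ((mu c).+1%:R)^-1 <= a ->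
  entropy_sq (multislice n mu) g <= a * energy (multislice n mu) g g.
Proof.
move=> ha; have [->|[u0 u0U]] := set_0Vmem (multislice n mu).
  rewrite /entropy_sq /energy !big_set0 mul0r subrr big1 ?mulr0// => t _.
  by rewrite /ip big_set0.
have := @phi_sobolev R l (fun x => x * ln x) Num.sqrt
  (@weighted_entropy_le R _) (@mean_coupling_sqrt R)
  n (fun u => g u ^+ 2) (fun u => sqr_ge0 _) setT u0.
rewrite (slice_multislice u0U) /phi_gap.
under [X in _ <= X]eq_bigr => u /multisliceP uU.
  rewrite (_ : sobolev_weight R setT u = 4 * \sum_c ((mu c).+1%:R)^-1); last first.
    by congr (_ * _); apply: eq_bigr => c _; rewrite uU.
  over.
rewrite -mulr_sumr energy_swap_energy => h.
have a4 : 0 <= 4 * \sum_c ((mu c).+1%:R)^-1 :> R.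
  by rewrite mulr_ge0// sumr_ge0// => c _; rewrite invr_ge0.
apply: (@le_trans _ _ (4 * (\sum_c ((mu c).+1%:R)^-1) * energy (multislice n mu) g
  g)); last first.
  by rewrite ler_wpM2r// energy_ge0.
have le_energy : energy (multislice n mu) (fun u => Num.sqrt (g u ^+ 2))
    (fun u => Num.sqrt (g u ^+ 2)) <= energy (multislice n mu) g g.
  apply: ler_sum => t _; apply: ler_sum => u _.
  rewrite /dswap !sqrtr_sqr -!expr2 -[leLHS]real_normK ?num_real//.
  rewrite -[leRHS]real_normK ?num_real//.
  by rewrite ler_sqr ?nnegrE// ler_dist_dist.
apply: le_trans (ler_wpM2l a4 le_energy); apply: le_trans h.
have U0 : #|multislice n mu|%:R != 0 :> R.
  by rewrite pnatr_eq0 -lt0n; apply/card_gt0P; exists u0.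
rewrite /entropy_sq lerD2l lerN2 mulrA.
by rewrite [X in X * ln _ <= _](_ : _ = \sum_(u in multislice n mu) g u ^+ 2)//
  mulrCA divff// mulr1.
Qed.

(** * Recoloring a single coordinate *)

Definition setc (n l : nat) (u : string n l) (j : 'I_n) (e : 'I_l) : string n l :=
  [ffun k => if k == j then e else u k].

Lemma setc_same (n l : nat) (u : string n l) j e : setc u j e j = e.
Proof. by rewrite ffunE eqxx. Qed.

Lemma setc_other (n l : nat) (u : string n l) j e k : k != j -> setc u j e k = u k.
Proof. by rewrite ffunE => /negbTE ->. Qed.

Lemma setc_setc (n l : nat) (u : string n l) j e : setc (setc u j e) j (u j) = u.
Proof. by apply/ffunP => k; rewrite !ffunE; case: eqP => [->|]. Qed.

(** Stated additively to avoid truncated subtraction. *)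
Lemma hist_setc (n l : nat) (u : string n l) j e a :
  ((u j == a) + hist setT (setc u j e) a = (e == a) + hist setT u a)%N.
Proof.
rewrite !(hist_D1 _ _ (in_setT j)) setc_same addnCA; congr (_ + (_ + _))%N.
apply: eq_card => k; rewrite !inE; case: (eqVneq k j) => //= kj.
by rewrite setc_other.
Qed.

Lemma setc_swapc (n l : nat) (u : string n l) (j k : 'I_n) :
  j != k -> setc (setc u j (u k)) k (u j) = swapc j k u.
Proof.
move=> jk; apply/ffunP => i; rewrite !ffunE.
by case: tpermP => [->|->|/eqP/negbTE -> /eqP/negbTE ->//]; rewrite eqxx// (negbTE jk).
Qed.

Section Shadow.
Variables (R : realType) (n l : nat) (kappa : histogram l).
Hypothesis kappa_gt0 : forall i, (0 < kappa i)%N.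
Variable A : {set string n l}.
Hypothesis AU : A \subset multislice n kappa.
Let U := multislice n kappa.
Let inA (u : string n l) : R := (u \in A)%:R.

(** * The shadow for one pair of colors *)

Section ColorPair.
Variables (c d : 'I_l).
Hypothesis cd : (c < d)%N.
Let U' := multislice n (recolor kappa c d).
Let B := upper_shadow (recolor kappa c d) A.

Lemma setc_recolor (u : string n l) j : u j = c -> (setc u j d \in U') = (u \in U).
Proof.
move=> uj; have k0 := kappa_gt0 c.
have cdn : c != d by apply: contraTneq cd => ->; rewrite ltnn.
apply/multisliceP/multisliceP => h a; have := h a; have := hist_setc u j d a;
  rewrite uj ffunE ![a == _]eq_sym.
  case: (eqVneq d a) => [<-|da]; first by rewrite (negbTE cdn); lia.
  by case: (eqVneq c a) => [<-|ca]; lia.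
case: (eqVneq d a) => [<-|da]; first by rewrite (negbTE cdn); lia.
by case: (eqVneq c a) => [<-|ca]; lia.
Qed.

(** Raising coordinate [j] from [c] to [d] is a bijection between the pairs [(u, j)] below and
    [(v, j)] above, inverted by lowering [j]. *)
Lemma sum_upper_edges (F : string n l -> 'I_n -> R) :
  \sum_(v in U') \sum_(j | v j == d) F v j
  = \sum_(u in U) \sum_(j | u j == c) F (setc u j d) j.
Proof.
rewrite !pair_big_dep /=.
rewrite (reindex_onto (fun uj : string n l * 'I_n => (setc uj.1 uj.2 d, uj.2))
   (fun vj => (setc vj.1 vj.2 c, vj.2))) /=; last first.
  by move=> [v j] /= /andP[_ /eqP vj]; rewrite -vj setc_setc.
apply: eq_bigl => -[u j] /=; rewrite setc_same eqxx andbT xpair_eqE eqxx andbT.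
have [uj|uj] := eqVneq (u j) c.
  by rewrite setc_recolor// -uj setc_setc eqxx andbT.
rewrite andbF; apply/negbTE/negP => /andP[_ /eqP e].
by move: uj; rewrite -e setc_same eqxx.
Qed.

Lemma card_colored (u : string n l) a : u \in U -> #|[pred j | u j == a]| = kappa a.
Proof.
by move=> /multisliceP <-; apply: eq_card => j; rewrite !inE.
Qed.

Lemma card_colored_upper (v : string n l) : v \in U' -> #|[pred j | v j == d]| =
  (kappa d).+1.
Proof.
move=> /multisliceP/(_ d); rewrite ffunE eqxx => <-.
by apply: eq_card => j; rewrite !inE.
Qed.

(** Edge count: [kappa d + 1] edges at each upper string, [kappa c] at each lower one. *)
Lemma card_shadow_slice : (#|U'| * (kappa d).+1 = #|U| * kappa c)%N.
Proof.
apply/eqP; rewrite -(eqr_nat R) !natrM !mulr_natl -!sumr_const; apply/eqP.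
transitivity (\sum_(v in U') \sum_(j | v j == d) (1 : R)).
  by apply: eq_bigr => v vU; rewrite sumr_const card_colored_upper.
rewrite sum_upper_edges; apply: eq_bigr => u uU.
by rewrite sumr_const card_colored.
Qed.

Lemma mem_shadow (v : string n l) j : v \in U' -> v j = d -> setc v j c \in A -> v
  \in B.
Proof.
move=> vU vj vA; rewrite inE vU /=; apply/existsP; exists (setc v j c).
rewrite vA /= /string_prec; apply/andP; split.
  apply/eqP => /ffunP/(_ j); rewrite setc_same vj => e.
  by move: cd; rewrite e ltnn.
apply/forallP => k; rewrite ffunE; case: eqP => // ->.
by rewrite vj ltnW.
Qed.

Let deg (v : string n l) : R := \sum_(j | v j == d) inA (setc v j c).

Lemma deg_ge0 v : 0 <= deg v.
Proof. by apply: sumr_ge0. Qed.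

Lemma deg_le v : v \in U' -> deg v <= (kappa d).+1%:R * (v \in B)%:R.
Proof.
move=> vU; case vB : (v \in B).
  rewrite mulr1 -(card_colored_upper vU) -sumr_const.
  by apply: ler_sum => j _; rewrite lern1 leq_b1.
rewrite mulr0 /deg big1// => j /eqP vj; rewrite /inA; case vA : (_ \in A) => //.
by rewrite (mem_shadow vU vj vA) in vB.
Qed.

Lemma sum_in_subset (V : {set string n l}) (C : {set string n l}) :
  C \subset V -> \sum_(u in V) (u \in C)%:R = #|C|%:R :> R.
Proof.
move=> CV; rewrite -natr_sum -big_mkcondr sum1_card; congr (_%:R).
apply: eq_card => u; rewrite unfold_in /=; apply: andb_idl.
exact: (subsetP CV).
Qed.

Lemma sum_deg : \sum_(v in U') deg v = (kappa c)%:R * #|A|%:R.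
Proof.
rewrite (sum_upper_edges (fun v j => inA (setc v j c))).
rewrite -(sum_in_subset AU) mulr_sumr; apply: eq_bigr => u uU.
rewrite (eq_bigr (fun=> inA u)) => [|j /eqP uj]; last by rewrite -uj setc_setc.
by rewrite sumr_const card_colored// mulr_natl.
Qed.

Definition boundary_pairs (a b : 'I_l) : R :=
  \sum_(u in U) \sum_(j | u j == a) \sum_(k | u k == b)
    inA u * (1 - inA (swapc j k u)).

(* Two lower neighbours of v, obtained by lowering j and k, differ by (j k). *)
Lemma sum_deg_codeg :
  \sum_(v in U') deg v * ((kappa d).+1%:R - deg v) = boundary_pairs c d.
Proof.
transitivity (\sum_(v in U') \sum_(j | v j == d) inA (setc v j c) *
    \sum_(k | v k == d) (1 - inA (setc v k c))).
  apply: eq_bigr => v vU; rewrite -mulr_suml; congr (_ * _).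
  by rewrite sumrB sumr_const card_colored_upper.
rewrite (sum_upper_edges (fun v j => inA (setc v j c) *
    \sum_(k | v k == d) (1 - inA (setc v k c)))).
apply: eq_bigr => u uU; apply: eq_bigr => j /eqP uj.
rewrite -{1}uj setc_setc (bigD1 j) ?setc_same//= -{1}uj setc_setc mulrDr.
(* The diagonal term [k = j] vanishes, leaving only genuine transpositions. *)
have -> : inA u * (1 - inA u) = 0.
  by rewrite /inA; case: (_ \in A); rewrite ?subrr ?mulr0 ?mul0r.
rewrite add0r mulr_sumr; apply: eq_big => [k|k /andP[+ kj]].
  case: (eqVneq k j) => [->|kj]; last by rewrite setc_other// andbT.
  by rewrite andbF uj; apply/esym/negbTE; apply: contraTneq cd => ->; rewrite ltnn.
by rewrite setc_other// => /eqP uk; rewrite -uk -uj setc_swapc// eq_sym.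
Qed.

Definition shadow_gain : R := vol R (recolor kappa c d) B - vol R kappa A.

Hypothesis U_gt0 : (0 < #|U|)%N.

Lemma shadow_gainE : (kappa d).+1%:R * #|B|%:R - (kappa c)%:R * #|A|%:R =
  (kappa c)%:R * #|U|%:R * shadow_gain.
Proof.
have U0 : #|U|%:R != 0 :> R by rewrite pnatr_eq0 -lt0n.
have k0 : (kappa c)%:R != 0 :> R by rewrite pnatr_eq0 -lt0n.
have d0 : (kappa d).+1%:R != 0 :> R by rewrite pnatr_eq0.
have E : #|U'|%:R = #|U|%:R * (kappa c)%:R / (kappa d).+1%:R :> R.
  by apply: (canRL (mulfK d0)); rewrite -!natrM card_shadow_slice.
rewrite /shadow_gain /vol -/U -/U' E mulrBr; congr (_ - _).
  rewrite -natr1 in d0 *; by field; rewrite U0 k0 d0.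
by field.
Qed.

Lemma shadow_sub : B \subset U'.
Proof. by apply/subsetP => v; rewrite inE => /andP[]. Qed.

(** With [D = kappa d + 1], each upper string satisfies [deg v * (D - deg v) <= D * (D * (v \in B) -
    deg v)], and the right sides sum to [D] times the gain expression of [shadow_gainE]. Finally
    [D <= 2 * kappa d]. *)
Lemma boundary_pairs_le :
  boundary_pairs c d <= 2 * #|U|%:R * ((kappa c)%:R * (kappa d)%:R * shadow_gain).
Proof.
have d0 : 0 < (kappa d)%:R :> R by rewrite ltr0n.
have D0 : 0 < (kappa d).+1%:R :> R by rewrite ltr0n.
have gain0 : 0 <= (kappa c)%:R * #|U|%:R * shadow_gain.
  rewrite -shadow_gainE subr_ge0 -sum_deg -(sum_in_subset shadow_sub) mulr_sumr.
  by apply: ler_sum => v vU; exact: deg_le.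
apply: (@le_trans _ _ ((kappa d).+1%:R * ((kappa c)%:R * #|U|%:R * shadow_gain))).
  rewrite -sum_deg_codeg -shadow_gainE -sum_deg -(sum_in_subset shadow_sub).
  rewrite mulr_sumr -sumrB mulr_sumr; apply: ler_sum => v vU.
  have := deg_le vU; have := deg_ge0 v; case: (v \in B) => h1 h2.
    rewrite mulr1 ler_wpM2r// ?subr_ge0; first by rewrite mulr1 in h2.
    by rewrite mulr1 in h2.
  have -> : deg v = 0 by apply/eqP; rewrite eq_le h1 andbT; rewrite mulr0 in h2.
  by rewrite mul0r mulr0 subrr mulr0.
have : (kappa d).+1%:R <= 2 * (kappa d)%:R :> R.
  by rewrite -natrM ler_nat; have := kappa_gt0 d; lia.
move=> /(ler_wpM2r gain0) /le_trans; apply; rewrite le_eqVlt; apply/orP; left.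
by apply/eqP; ring.
Qed.

Lemma shadow_gain_ge0 : 0 <= shadow_gain.
Proof.
have : 0 <= (kappa c)%:R * #|U|%:R * shadow_gain.
  rewrite -shadow_gainE subr_ge0 -sum_deg -(sum_in_subset shadow_sub) mulr_sumr.
  by apply: ler_sum => v vU; exact: deg_le.
by rewrite pmulr_rge0// mulr_gt0// ltr0n.
Qed.

(** * The shadow with one coordinate fixed *)

Section Coordinate.
Variable i : 'I_n.

(** The degree count restricted to strings with color [e] at [i]. Raising [j] preserves this color
    unless [j = i], which is possible only when [e = c]; hence the correction by one. *)
Lemma card_shadow_fiber_ge e : e != d ->
  ((kappa c)%:R - (e == c)%:R) * #|fiber A i e|%:R
  <= (kappa d).+1%:R * #|fiber B i e|%:R :> R.
Proof.
move=> ed.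
have fAU : fiber A i e \subset U.
  by apply/subsetP => u; rewrite inE => /andP[/(subsetP AU)].
have fBU : fiber B i e \subset U'.
  by apply/subsetP => u; rewrite inE => /andP[/(subsetP shadow_sub)].
rewrite -(sum_in_subset fAU) -(sum_in_subset fBU).
apply: (@le_trans _ _ (\sum_(v in U') \sum_(j | v j == d)
    (v i == e)%:R * inA (setc v j c))).
  rewrite (sum_upper_edges (fun v j => (v i == e)%:R * inA (setc v j c))).
  rewrite mulr_sumr; apply: ler_sum => u uU.
  rewrite (eq_bigr (fun j => (setc u j d i == e)%:R * inA u)); last first.
    by move=> j /eqP uj; rewrite -[in LHS]uj setc_setc.
  rewrite -mulr_suml inE /inA; case: (u \in A); last by rewrite !mulr0.
  rewrite mulr1 /=; case: (eqVneq (u i) e) => [ui|_]; last by rewrite mulr0 sumr_ge0.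
  rewrite mulr1 -(card_colored c uU) -sumr_const.
  have -> : (e == c)%:R = \sum_(j | u j == c) (j == i)%:R :> R.
    rewrite -ui -natr_sum -big_mkcondr /= sum1dep_card; congr (_%:R).
    case: eqP => uic.
      rewrite (_ : [set j | _] = [set i]) ?cards1//.
      by apply/setP => j; rewrite !inE andb_idl// => /eqP->; rewrite uic.
    rewrite (_ : [set j | _] = set0) ?cards0//.
    apply/setP => j; rewrite !inE; apply/negP => /andP[/eqP uj /eqP ji].
    by apply: uic; rewrite -ji.
  rewrite -sumrB; apply: ler_sum => j _; case: (eqVneq j i) => [_|ji].
    by rewrite subrr.
  by rewrite setc_other 1?eq_sym// ui eqxx subr0.
rewrite mulr_sumr; apply: ler_sum => v vU.
rewrite -mulr_sumr; have := deg_le vU; rewrite /deg.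
have -> : (v \in fiber B i e) = (v \in B) && (v i == e) by rewrite inE.
case: (v i == e); rewrite ?andbF ?andbT ?mul1r// mul0r.
by rewrite mulr0.
Qed.

(* Strings that reach the shadow by raising some j <> i, but not by raising i. *)
Definition exceptional : {set string n l} :=
  [set v in U' | [&& v i == d, setc v i c \notin A &
     [exists j, [&& j != i, v j == d & setc v j c \in A]]]].

(** Raising coordinate [i] embeds the strings of [A] with color [c] there into the shadow; the image
    avoids [exceptional] because lowering [i] leads back to [A]. *)
Lemma card_exceptional_add : (#|fiber A i c| + #|exceptional| <= #|fiber B i d|)%N.
Proof.
have injX : {in fiber A i c &, injective (fun u => setc u i d)}.
  move=> u u'; rewrite !inE => /andP[_ /eqP ui] /andP[_ /eqP ui'] e.
  by rewrite -(setc_setc u i d) -(setc_setc u' i d) e ui ui'.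
rewrite -(card_in_imset injX); set X := imset _ _.
have XQ : [disjoint X & exceptional].
  rewrite disjoint_subset; apply/subsetP => v /imsetP[u].
  rewrite !inE => /andP[uA /eqP ui] ->.
  by rewrite -{2}ui setc_setc uA !andbF.
have := leq_card_setU X exceptional; rewrite XQ => -[_ /eqP <-].
apply: subset_leq_card; apply/subsetP => v; rewrite inE => /orP[].
  move=> /imsetP[u]; rewrite inE => /andP[uA /eqP ui] ->.
  have uU := subsetP AU u uA.
  rewrite inE setc_same eqxx andbT; apply: (@mem_shadow _ i).
  - by rewrite setc_recolor.
  - by rewrite setc_same.
  - by rewrite -ui setc_setc.
rewrite inE => /andP[vU /and3P[vi _ /existsP[j /and3P[_ /eqP vj vA]]]].
by rewrite inE vi andbT; exact: mem_shadow vA.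
Qed.

(* On u_i = d the shadow contains the copy of {u in A : u_i = c} and the
   exceptional strings; on the other values of u_i the degree count is used. *)
Lemma exceptional_le_gain : (kappa d).+1%:R * #|exceptional|%:R <=
  (kappa c)%:R * #|U|%:R * shadow_gain
  + (kappa c)%:R * #|fiber A i d|%:R - (kappa d)%:R * #|fiber A i c|%:R.
Proof.
rewrite -shadow_gainE.
have cdn : c != d by apply: contraTneq cd => ->; rewrite ltnn.
have card_sum (C : {set string n l}) : \sum_e #|fiber C i e|%:R = #|C|%:R :> R.
  rewrite -[RHS]mulr1 mulr_natl -sumr_const -(sum_fiber C i).
  by apply: eq_bigr => e _; rewrite sumr_const.
have hQ : #|fiber A i c|%:R + #|exceptional|%:R <= #|fiber B i d|%:R :> R.
  by rewrite -natrD ler_nat card_exceptional_add.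
have D0 : 0 < (kappa d).+1%:R :> R by rewrite ltr0n.
have := ler_wpM2l (ltW D0) hQ.
have hrest : \sum_(e | e != d) ((kappa c)%:R - (e == c)%:R) * #|fiber A i e|%:R
    <= \sum_(e | e != d) (kappa d).+1%:R * #|fiber B i e|%:R :> R.
  by apply: ler_sum => e; exact: card_shadow_fiber_ge.
have eA : \sum_(e | e != d) ((kappa c)%:R - (e == c)%:R) * #|fiber A i e|%:R
   = (kappa c)%:R * (#|A|%:R - #|fiber A i d|%:R) - #|fiber A i c|%:R :> R.
  under eq_bigr do rewrite mulrBl.
  rewrite sumrB -mulr_sumr -(card_sum A) [in RHS](bigD1 d)//= addrAC subrr add0r.
  congr (_ - _); rewrite (bigD1 c)//= eqxx mul1r big1 ?addr0// => e.
  by move=> /andP[_ /negbTE ->]; rewrite mul0r.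
have eB : (kappa d).+1%:R * #|B|%:R = (kappa d).+1%:R * #|fiber B i d|%:R
   + \sum_(e | e != d) (kappa d).+1%:R * #|fiber B i e|%:R :> R.
  by rewrite -mulr_sumr -mulrDr -(card_sum B) (bigD1 d).
move: hrest; rewrite eA eB -natr1; lra.
Qed.

Lemma corrE e : corr R kappa A i e d = 
   #|fiber A i d|%:R / #|fiber U i d|%:R - #|fiber A i e|%:R / #|fiber U i e|%:R.
Proof.
have E1 a : U :&: [set u : string n l | u i == a] = fiber U i a.
  by apply/setP => u; rewrite !inE.
have E2 a : U :&: [set u : string n l | u i == a] :&: A = fiber A i a.
  rewrite E1; apply/setP => u; rewrite in_setI ![u \in fiber _ _ _]inE andbC andbA.
  by congr (_ && _); apply: andb_idr; exact: (subsetP AU).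
by rewrite /corr /cond_prob -/U !E2 !E1.
Qed.

Lemma corr_fiber : (kappa c)%:R * (kappa d)%:R * #|U|%:R * corr R kappa A i c d =
  n%:R * ((kappa c)%:R * #|fiber A i d|%:R - (kappa d)%:R * #|fiber A i c|%:R).
Proof.
have U0 : #|U|%:R != 0 :> R by rewrite pnatr_eq0 -lt0n.
have k0 a : (kappa a)%:R != 0 :> R by rewrite pnatr_eq0 -lt0n.
have n0 : n%:R != 0 :> R by rewrite pnatr_eq0 -lt0n (leq_trans _ (ltn_ord i)).
have E a : #|fiber U i a|%:R = (kappa a)%:R * #|U|%:R / n%:R :> R.
  by apply: (canRL (mulfK n0)); rewrite -!natrM card_multislice_fiber.
by rewrite corrE !E; field; rewrite n0 U0 !k0.
Qed.

(** In [exceptional_le_gain], [kappa c <= n <= kappa d / p] controls the gain term, while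
    [corr_fiber] and [kappa c <= n] turn the difference of fibers into the correlation. *)
Lemma card_exceptional_le (p eta : R) : 0 < p -> 0 <= eta ->
  p <= (kappa d)%:R / n%:R -> corr R kappa A i c d <= eta ->
  #|exceptional|%:R <= #|U|%:R * (shadow_gain / p + eta).
Proof.
move=> p0 eta0 hp hc; have G0 := shadow_gain_ge0.
have n0 : 0 < n%:R :> R by rewrite ltr0n (leq_trans _ (ltn_ord i)).
have U0 : 0 < #|U|%:R :> R by rewrite ltr0n.
have kc0 : 0 < (kappa c)%:R :> R by rewrite ltr0n.
have kd0 : 0 < (kappa d)%:R :> R by rewrite ltr0n.
have D0 : 0 < (kappa d).+1%:R :> R by rewrite ltr0n.
have kcn : (kappa c)%:R <= n%:R :> R.
  have /card_gt0P[u0 u0U] := U_gt0.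
  by rewrite ler_nat -(card_colored c u0U) (leq_trans (max_card _))// card_ord.
have nd : n%:R <= (kappa d)%:R / p.
  by rewrite ler_pdivlMr// mulrC -ler_pdivlMr.
set X : R := (kappa c)%:R * #|fiber A i d|%:R - (kappa d)%:R * #|fiber A i c|%:R.
have hX : X <= (kappa d)%:R * #|U|%:R * eta.
  rewrite -(ler_pM2l n0) -corr_fiber.
  apply: (@le_trans _ _ ((kappa c)%:R * (kappa d)%:R * #|U|%:R * eta)).
    by rewrite ler_wpM2l// !mulr_ge0.
  by rewrite -!mulrA ler_wpM2r// !mulr_ge0.
rewrite -(ler_pM2l D0); apply: (le_trans exceptional_le_gain).
rewrite -addrA -/X.
have h1 : (kappa c)%:R * #|U|%:R * shadow_gain <= (kappa d)%:R * (#|U|%:R *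
  (shadow_gain / p)).
  have -> : (kappa d)%:R * (#|U|%:R * (shadow_gain / p)) = (kappa d)%:R / p *
    (#|U|%:R * shadow_gain) by ring.
  by rewrite -mulrA ler_wpM2r ?mulr_ge0 ?(le_trans kcn)// ltW.
apply: (le_trans (lerD h1 hX)).
have -> : (kappa d)%:R * (#|U|%:R * (shadow_gain / p)) + (kappa d)%:R * #|U|%:R * eta
   = (kappa d)%:R * (#|U|%:R * (shadow_gain / p + eta)) by ring.
by rewrite ler_wpM2r ?ler_nat// mulr_ge0 ?addr_ge0 ?divr_ge0// ltW.
Qed.

(* u |-> u with coordinate j raised to d is an injection. *)
Lemma card_swap_out_le j :
  (#|[set u in A | [&& u i == d, u j == c & swapc i j u \notin A]]|
   <= #|exceptional|)%N.
Proof.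
set Z := finset _.
have ZP u : u \in Z -> [/\ u \in A, u i = d, u j = c & swapc i j u \notin A].
  by rewrite inE => /andP[uA /and3P[/eqP ui /eqP uj us]].
have injZ : {in Z &, injective (fun u => setc u j d)}.
  move=> u u' /ZP[_ _ uj _] /ZP[_ _ uj' _] e.
  by rewrite -(setc_setc u j d) -(setc_setc u' j d) e uj uj'.
rewrite -(card_in_imset injZ); apply: subset_leq_card.
apply/subsetP => v /imsetP[u /ZP[uA ui uj us] ->].
have uU := subsetP AU u uA.
have ji : j != i.
  by apply: contraTneq cd => ji; rewrite -ui -uj ji ltnn.
rewrite inE setc_recolor// uU /= setc_other 1?eq_sym// ui eqxx /=.
apply/andP; split; first by rewrite -{1}ui -uj setc_swapc// swapcC.
by apply/existsP; exists j; rewrite ji setc_same eqxx -uj setc_setc.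
Qed.

End Coordinate.
End ColorPair.

(** * Summation over all pairs of colors *)

Lemma boundary_pairsC a b : boundary_pairs a b = boundary_pairs b a.
Proof.
apply: eq_bigr => u _; rewrite exchange_big; apply: eq_bigr => j _.
by apply: eq_bigr => k _; rewrite swapcC.
Qed.

Lemma boundary_pairs_diag a : boundary_pairs a a = 0.
Proof.
rewrite /boundary_pairs big1// => u _; rewrite big1// => j /eqP uj.
rewrite big1// => k /eqP uk.
have -> : swapc j k u = u.
  by apply/ffunP => x; rewrite ffunE; case: tpermP => [->|->|//]; rewrite uj uk.
by rewrite /inA; case: (u \in A); rewrite ?subrr ?mulr0 ?mul0r.
Qed.

(** The squared derivative marks strings that leave or enter [A]; the swap matches the two kinds,
    whence the factor 2. *)
Lemma influence01 t : ip U (dswap t inA) (dswap t inA) =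
  2 * \sum_(u in U) inA u * (1 - inA (swapc t.1 t.2 u)).
Proof.
have swU i j u : (swapc i j u \in U) = (u \in U) by exact: swapc_multislice.
have e : \sum_(u in U) inA (swapc t.1 t.2 u) * (1 - inA u) =
    \sum_(u in U) inA u * (1 - inA (swapc t.1 t.2 u)).
  rewrite -(sum_swapc swU t).
  by apply: eq_bigr => u _; rewrite swapcK.
rewrite mulr_natl mulr2n -{1}e -big_split; apply: eq_bigr => u _.
by rewrite /dswap /inA /=; case: (u \in A); case: (swapc _ _ _ \in A) => /=; ring.
Qed.

Lemma energy_boundary_pairs : energy U inA inA =
  2 * \sum_a \sum_b boundary_pairs a b.
Proof.
rewrite /energy (eq_bigr _ (fun t _ => influence01 t)) -mulr_sumr; congr (_ * _).
rewrite exchange_big /= /boundary_pairs.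
under [RHS]eq_bigr do rewrite exchange_big.
rewrite [RHS]exchange_big; apply: eq_bigr => u _ /=.
rewrite -(pair_bigA _ (fun j k => inA u * (1 - inA (swapc j k u)))) /=.
rewrite (partition_big u xpredT)//=; apply: eq_bigr => a _.
rewrite exchange_big /= [LHS](partition_big u xpredT)//=.
apply: eq_bigr => b _; rewrite [RHS]exchange_big.
done.
Qed.

(** Strings are split by their colors at the two coordinates. Equal colors give a trivial swap;
    otherwise [card_swap_out_le] applies at the coordinate with the larger color. *)
Lemma influence_le_exceptional (theta : R) t :
  (forall i (c d : 'I_l), (c < d)%N -> #|exceptional c d i|%:R <= theta) ->
  0 <= theta ->
  ip U (dswap t inA) (dswap t inA) <= 2 * l%:R ^+ 2 * theta.
Proof.
case: t => i j hQ theta0; rewrite influence01 -mulrA ler_pM2l//=.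
rewrite (partition_big (fun u : string n l => (u i, u j)) xpredT)//=.
rewrite (_ : l%:R ^+ 2 * theta = \sum_(ab : 'I_l * 'I_l) theta); last first.
  by rewrite sumr_const card_prod !card_ord -[RHS]mulr_natl natrM expr2.
apply: ler_sum => -[a b] _.
rewrite (eq_bigr (fun u => (u \in [set u in A | swapc i j u \notin A])%:R)); last first.
  move=> u _; rewrite inE /inA; case: (u \in A); case: (swapc _ _ _ \in A) => /=; ring.
rewrite -natr_sum -big_mkcondr sum1dep_card /=.
have h (x y : 'I_l) k k' : (x < y)%N ->
    #|[set u in A | [&& u k == y, u k' == x & swapc k k' u \notin A]]|%:R <= theta.
  move=> xy; apply: le_trans (hQ k x y xy); rewrite ler_nat.
  exact: card_swap_out_le.
case: (ltngtP a b) => ab.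
- apply: le_trans (h a b j i ab); rewrite ler_nat; apply: subset_leq_card.
  apply/subsetP => u; rewrite !inE xpair_eqE swapcC.
  by move=> /andP[/andP[_ /andP[-> ->]] /andP[-> ->]].
- apply: le_trans (h b a i j ab); rewrite ler_nat; apply: subset_leq_card.
  apply/subsetP => u; rewrite !inE xpair_eqE.
  by move=> /andP[/andP[_ /andP[-> ->]] /andP[-> ->]].
- rewrite (_ : [set u | _] = set0) ?cards0//.
  apply/setP => u; rewrite !inE xpair_eqE; apply/negP.
  move=> /andP[/andP[_ /andP[/eqP ui /eqP uj]] /andP[uA]].
  rewrite (_ : swapc i j u = u) ?uA//.
  apply/ffunP => x; rewrite ffunE; case: tpermP => [->|->|//]; rewrite ui uj;
    by apply/val_inj; rewrite /= ab.
Qed.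

Hypothesis U_gt0 : (0 < #|U|)%N.

Definition expected_gain : R :=
  expect_upper n kappa (fun k => vol R k (upper_shadow k A)) - vol R kappa A.

(** Ordered pairs of coordinates are sorted by their colors; exactly [kappa a * kappa b] of them
    have colors [(a, b)]. *)
Lemma expected_gainE (u0 : string n l) : u0 \in U -> (0 < #|distinct_pairs u0|)%N ->
  #|distinct_pairs u0|%:R * expected_gain =
  \sum_a \sum_(b | a != b) (kappa a)%:R * (kappa b)%:R *
     shadow_gain (Order.min a b) (Order.max a b).
Proof.
move=> uU M0; rewrite /expected_gain (expect_upperE _ uU) mulrBr mulrC divfK;
  last first.
  by rewrite pnatr_eq0 -lt0n.
rewrite mulr_natl -sumr_const -sumrB.
rewrite (partition_big (fun jj : 'I_n * 'I_n => u0 jj.1) xpredT)//=.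
apply: eq_bigr => a _.
rewrite (partition_big (fun jj : 'I_n * 'I_n => u0 jj.2) (fun b => a != b))/=;
  last first.
  by move=> jj /andP[+ /eqP <-]; rewrite inE.
apply: eq_bigr => b ab.
rewrite (eq_bigr (fun=> shadow_gain (Order.min a b) (Order.max a b))); last first.
  by move=> jj /andP[/andP[_ /eqP <-] /eqP <-].
rewrite -(card_colored a uU) -(card_colored b uU) -natrM -cardX sumr_const
  -[LHS]mulr_natl.
congr (_%:R * _); apply: eq_card => -[j k]; rewrite unfold_in /= !inE /=.
by case: (u0 j =P a) => [->|_]; case: (u0 k =P b) => [->|_]; rewrite ?ab ?andbF.
Qed.

Lemma weighted_gain_ge0 a b : a != b ->
  0 <= (kappa a)%:R * (kappa b)%:R * shadow_gain (Order.min a b) (Order.max a b).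
Proof.
move=> ab; rewrite !mulr_ge0//; apply: shadow_gain_ge0 => //.
by case: (ltgtP a b) ab.
Qed.

Lemma boundary_pairs_le_gain a b : a != b -> boundary_pairs a b <=
  2 * #|U|%:R * ((kappa a)%:R * (kappa b)%:R
                 * shadow_gain (Order.min a b) (Order.max a b)).
Proof.
move=> ab; case: (ltgtP a b) ab => [ab _|ba _|//].
  exact: boundary_pairs_le.
rewrite boundary_pairsC [(kappa a)%:R * _]mulrC; exact: boundary_pairs_le.
Qed.

(** All terms of [expected_gainE] are nonnegative and there are at most [n ^+ 2] pairs, so both the
    full sum and a single term are at most [n ^+ 2] times the expected gain. *)
Lemma expected_gain_ge (c d : 'I_l) : (c < d)%N ->
  [/\ 0 <= expected_gain,
   energy U inA inA <= 4 * #|U|%:R * (n%:R ^+ 2 * expected_gain) &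
   (kappa c)%:R * (kappa d)%:R * shadow_gain c d <= n%:R ^+ 2 * expected_gain].
Proof.
move=> cd; have /card_gt0P[u0 u0U] := U_gt0.
have cdn : c != d by apply: contraTneq cd => ->; rewrite ltnn.
have M0 : (0 < #|distinct_pairs u0|)%N.
  have ex e : exists j, u0 j = e.
    have := kappa_gt0 e; rewrite -(card_colored e u0U) => /card_gt0P[j].
    by rewrite inE => /eqP; exists j.
  have [[j uj] [k uk]] := (ex c, ex d).
  by apply/card_gt0P; exists (j, k); rewrite inE /= uj uk.
have Mn : #|distinct_pairs u0|%:R <= n%:R ^+ 2 :> R.
  rewrite -natrX ler_nat (leq_trans (max_card _))//.
  by rewrite card_prod card_ord mulnn.
have E := expected_gainE u0U M0; set T := \sum_a _ in E.
have T0 : 0 <= T.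
  by do 2!(apply: sumr_ge0 => ? ?); exact: weighted_gain_ge0.
have G0 : 0 <= expected_gain.
  by move: T0; rewrite -E pmulr_rge0// ltr0n.
have TG : T <= n%:R ^+ 2 * expected_gain by rewrite -E ler_wpM2r.
split => //.
  apply: (@le_trans _ _ (4 * #|U|%:R * T)); last by rewrite ler_wpM2l// mulr_ge0.
  rewrite energy_boundary_pairs (_ : 4 = 2 * 2); last by rewrite -natrM.
  rewrite -!mulrA ler_pM2l// mulrA !mulr_sumr; apply: ler_sum => a _.
  rewrite mulr_sumr (bigD1 a)//= boundary_pairs_diag add0r.
  rewrite (eq_bigl (fun b => a != b)) => [|b]; last by rewrite eq_sym.
  by apply: ler_sum => b; exact: boundary_pairs_le_gain.
apply: le_trans TG; rewrite /T (bigD1 c)//= (bigD1 d)//= -addrA.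
rewrite [Order.min c d](_ : _ = c); last by apply/min_idPl; exact: ltnW.
rewrite [Order.max c d](_ : _ = d); last by apply/max_idPr; exact: ltnW.
rewrite lerDl addr_ge0//.
  by apply: sumr_ge0 => b /andP[ab _]; exact: weighted_gain_ge0.
by do 2!(apply: sumr_ge0 => ? ?); exact: weighted_gain_ge0.
Qed.

End Shadow.

(** * Choice of the constants *)

(** [ln x] is twice the logarithm of the square root of [x], which lies below that root. *)
Lemma ln_le_powR_half (R : realType) (x : R) : 1 <= x -> ln x / x <= 2 * x `^ (- (1
  / 2)).
Proof.
move=> x1; have x0 : 0 < x by exact: lt_le_trans x1.
have s0 : 0 < x `^ (1 / 2) by rewrite powR_gt0.
have sE : x `^ (1 / 2) * x `^ (1 / 2) = x.
  by rewrite -powRD ?(gt_eqF x0) ?implybT// -splitr powRr1// ltW.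
have := ln_sublinear s0; rewrite ln_powR => h.
rewrite powRN -{2}sE ler_pdivrMr ?mulr_gt0//.
have -> : 2 / x `^ (1 / 2) * (x `^ (1 / 2) * x `^ (1 / 2)) = 2 * x `^ (1 / 2).
  by field; rewrite gt_eqF.
lra.
Qed.

Section Gain.
Variables (R : realType) (n l : nat) (kappa : histogram l) (p : R).
Hypothesis l_ge2 : (2 <= l)%N.
Hypothesis p_gt0 : 0 < p.
Hypothesis kappa_gt0 : forall i, (0 < kappa i)%N.
Hypothesis sum_kappa : (\sum_i kappa i)%N = n.
Hypothesis kappa_ge : forall i, p <= (kappa i)%:R / n%:R.
Variable A : {set string n l}.
Hypothesis AU : A \subset multislice n kappa.
Hypothesis U_gt0 : (0 < #|multislice n kappa|)%N.
Let U := multislice n kappa.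
Let inA (u : string n l) : R := (u \in A)%:R.
Let Gamma : R := expected_gain R kappa A.

Lemma coord_gt0 : (0 < n)%N.
Proof.
have := kappa_gt0 (Ordinal (ltnW l_ge2)).
by rewrite -sum_kappa (bigD1 (Ordinal (ltnW l_ge2)))//= => /leq_trans; apply;
  rewrite leq_addr.
Qed.

(** As every [kappa e] is at least [p * n], a single [shadow_gain] is at most [Gamma / p ^+ 2]; the
    further [/ p] comes from [card_exceptional_le]. *)
Lemma influence_le_corr (eta : R) t : 0 <= eta ->
  (forall (j : 'I_n) (c d : 'I_l), (c < d)%N -> corr R kappa A j c d <= eta) ->
  ip U (dswap t inA) (dswap t inA)
  <= 2 * l%:R ^+ 2 * (#|U|%:R * (Gamma / p ^+ 2 / p + eta)).
Proof.
move=> eta0 hc; have n0 : 0 < n%:R :> R by rewrite ltr0n coord_gt0.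
have c01 : (Ordinal (ltnW l_ge2) < Ordinal l_ge2)%N by [].
have [G0 _ _] := expected_gain_ge R kappa_gt0 AU U_gt0 c01.
apply: (influence_le_exceptional kappa_gt0 AU) => [i c d cd|]; last first.
  by rewrite mulr_ge0// addr_ge0// divr_ge0 ?divr_ge0 ?sqr_ge0 ?(ltW p_gt0).
have hQ := card_exceptional_le kappa_gt0 AU cd U_gt0 p_gt0 eta0 (kappa_ge d) (hc i
  c d cd).
apply: (le_trans hQ); rewrite ler_wpM2l// lerD2r ler_wpM2r ?invr_ge0 ?(ltW p_gt0)//.
have [_ _ hG] := expected_gain_ge R kappa_gt0 AU U_gt0 cd.
rewrite ler_pdivlMr ?exprn_gt0// -(ler_pM2l (exprn_gt0 2 n0)).
apply: le_trans hG.
have kp e : n%:R * p <= (kappa e)%:R by rewrite mulrC -ler_pdivlMr.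
have -> : n%:R ^+ 2 * (shadow_gain R kappa A c d * p ^+ 2) =
   (n%:R * p) * (n%:R * p) * shadow_gain R kappa A c d by ring.
rewrite ler_wpM2r ?shadow_gain_ge0// ler_pM ?mulr_ge0 ?(ltW p_gt0) ?(ltW n0)//.
Qed.

Lemma gain_ge (alpha : nat) (r eps : R) : 0 < r -> r <= 1 ->
  4 * l%:R / p <= alpha%:R ->
  (forall t, ip U (dswap t inA) (dswap t inA) <= r ^+ 4 * #|U|%:R) ->
  eps <= vol R kappa A <= 1 - eps -> 0 <= eps ->
  - 2 * ln r * eps ^+ 2 <= 36 * alpha%:R * n%:R * Gamma.
Proof.
move=> r0 r1 ha hI /andP[v1 v2] eps0.
have n_pos := coord_gt0; have n0 : 0 < n%:R :> R by rewrite ltr0n.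
have U0 : 0 < #|U|%:R :> R by rewrite ltr0n.
have l0 : 0 < l%:R :> R by rewrite ltr0n ltnW.
have a0 : 0 < alpha%:R :> R.
  by apply: lt_le_trans ha; rewrite divr_gt0// mulr_gt0.
pose a : R := alpha%:R / n%:R.
(* Each [kappa c] is at least [p * n], so [a] is admissible as Sobolev constant. *)
have a4 : 4 * \sum_c ((kappa c).+1%:R)^-1 <= a.
  apply: (@le_trans _ _ (4 * l%:R / p / n%:R));
    last by rewrite ler_wpM2r// invr_ge0 ltW.
  rewrite -!mulrA ler_pM2l//.
  rewrite (_ : l%:R * _ = \sum_(c < l) (p^-1 * n%:R^-1)); last first.
    by rewrite sumr_const card_ord mulr_natl.
  apply: ler_sum => c _; rewrite -invfM lef_pV2 ?posrE ?mulr_gt0// ?ltr0n//.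
  apply: (@le_trans _ _ (kappa c)%:R); last by rewrite ler_nat.
  by rewrite -ler_pdivlMr.
have c01 : (Ordinal (ltnW l_ge2) < Ordinal l_ge2)%N by [].
have [G0 hE _] := expected_gain_ge R kappa_gt0 AU U_gt0 c01.
(* The horizon [K = 4 * alpha * n] makes [a] and [K / (2 * N)] of the same order [alpha / n], since
   [N = n ^+ 2]. With [r <= 1] the two factors are [3 * alpha / n] and at most [12 * alpha * n],
   whence the 36. *)
have := @kkl_energy R n l U n_pos (fun i j u => swapc_multislice kappa u i j)
  a (ltW (divr_gt0 a0 n0)) U_gt0 (fun g => multislice_logsobolev g a4)
  (fun g g0 => multislice_poincare a4 g0) inA r _ r0 hI (4 * alpha * n)%N r1.
rewrite card_prod card_ord.
have inA01 u : inA u = 0 \/ inA u = 1 by rewrite /inA; case: (u \in A); [right|left].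
move=> /(_ inA01).
have sA : \sum_(u in U) inA u = #|A|%:R by exact: sum_in_subset.
have ipA : ip U inA inA = #|A|%:R.
  rewrite -sA; apply: eq_bigr => u _; rewrite /inA.
  by case: (u \in A); rewrite ?mulr1 ?mulr0.
set v := vol R kappa A in v1 v2.
have vA : #|A|%:R = #|U|%:R * v :> R by rewrite /v /vol mulrC divfK// gt_eqF.
rewrite sA ipA vA !natrM.
set e0 := energy U inA inA; set L := - 2 * ln r.
have L0 : 0 <= L by rewrite /L mulNr -mulrN mulr_ge0// oppr_ge0 ln_le0.
have -> : #|U|%:R * v - (#|U|%:R * v) ^+ 2 / #|U|%:R = #|U|%:R * (v * (1 - v)).
  by field; rewrite gt_eqF.
have -> : a + 4 * alpha%:R * n%:R / (2 * (n%:R * n%:R)) = 3 * alpha%:R / n%:R.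
  by rewrite /a; field; rewrite gt_eqF.
have -> : 2 * (4 * alpha%:R * n%:R) * r + 4 * a * (n%:R * n%:R)
    = alpha%:R * n%:R * (8 * r + 4).
  by rewrite /a; field; rewrite gt_eqF.
move=> h.
have e00 : 0 <= e0 by exact: energy_ge0.
have h1 : 3 * alpha%:R / n%:R * (alpha%:R * n%:R * (8 * r + 4) * e0)
    <= 36 * alpha%:R ^+ 2 * (4 * #|U|%:R * (n%:R ^+ 2 * Gamma)).
  have -> : 3 * alpha%:R / n%:R * (alpha%:R * n%:R * (8 * r + 4) * e0)
     = 3 * alpha%:R ^+ 2 * ((8 * r + 4) * e0) by field; rewrite gt_eqF.
  have -> : 36 * alpha%:R ^+ 2 * (4 * #|U|%:R * (n%:R ^+ 2 * Gamma)) =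
     3 * alpha%:R ^+ 2 * (12 * (4 * #|U|%:R * (n%:R ^+ 2 * Gamma))) by ring.
  rewrite ler_wpM2l ?mulr_ge0 ?sqr_ge0//.
  apply: (@le_trans _ _ (12 * e0)); last by rewrite ler_pM2l.
  rewrite ler_wpM2r//; lra.
have h2 := le_trans h h1.
have vv : eps ^+ 2 <= v * (1 - v) by rewrite expr2 ler_pM//; lra.
have h3 : L * (4 * alpha%:R * n%:R * (#|U|%:R * eps ^+ 2)) <=
    L * (4 * alpha%:R * n%:R * (#|U|%:R * (v * (1 - v)))).
  by rewrite ler_wpM2l// ler_pM2l ?mulr_gt0// ler_pM2l.
have := le_trans h3 h2.
have k0 : 0 < 4 * alpha%:R * n%:R * #|U|%:R :> R by rewrite !mulr_gt0.
have -> : L * (4 * alpha%:R * n%:R * (#|U|%:R * eps ^+ 2)) =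
   4 * alpha%:R * n%:R * #|U|%:R * (L * eps ^+ 2) by ring.
have -> : 36 * alpha%:R ^+ 2 * (4 * #|U|%:R * (n%:R ^+ 2 * Gamma)) =
   4 * alpha%:R * n%:R * #|U|%:R * (36 * alpha%:R * n%:R * Gamma) by ring.
by rewrite ler_pM2l.
Qed.

End Gain.

Theorem theorem4p11 (R : realType) (l0 : nat) (hl0 : (2 <= l0)%N)
    (p eps : R) (hp : 0 < p) (heps : 0 < eps) :
  exists (c0 : R) (n0 : nat), 0 < c0 /\
    forall n : nat, (n0 <= n)%N ->
    forall l : nat, (2 <= l <= l0)%N ->
    forall kappa : histogram l,
      (forall i, 0 < kappa i)%N ->
      (\sum_i kappa i)%N = n ->
      (forall i, p <= (kappa i)%:R / n%:R) ->
    forall A : {set string n l},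
      A \subset multislice n kappa ->
      eps <= vol R kappa A <= 1 - eps ->
      expect_upper n kappa (fun kappa' => vol R kappa' (upper_shadow kappa' A))
        >= vol R kappa A + c0 * (ln n%:R / n%:R)
      \/ exists (j : 'I_n) (c d : 'I_l),
           (c < d)%N /\ corr R kappa A j c d >= 1 / n%:R `^ (1 / 100).
Proof.
(* A natural number, because [4 * alpha * n] counts steps of the walk. *)
pose alpha := Num.bound (4 * l0%:R / p).
have l00 : 0 < l0%:R :> R by rewrite ltr0n ltnW.
have halpha : 4 * l0%:R / p < alpha%:R.
  by apply: archi_boundP; rewrite divr_ge0 ?mulr_ge0// ltW.
have alpha0 : 0 < alpha%:R :> R.
  by apply: le_lt_trans halpha; rewrite divr_ge0 ?mulr_ge0// ltW.
have alpha1 : 1 <= alpha%:R :> R by rewrite ler1n -(ltr0n R).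
(* The factor of [eta] in [influence_le_corr] after inserting [Gamma <= 2 * eta] and [l <= l0]. *)
pose C : R := 2 * l0%:R ^+ 2 * (2 / p ^+ 2 / p + 1).
have C0 : 0 <= C.
  by rewrite !mulr_ge0 ?addr_ge0 ?divr_ge0 ?sqr_ge0// ltW.
(* [120 * 120 = 36 * 400]: the 36 comes from [gain_ge], and [-2 * ln r = ln n / 400]. *)
pose c0 : R := eps ^+ 2 / (120 * 120 * alpha%:R).
have c00 : 0 < c0 by rewrite divr_gt0 ?exprn_gt0 ?mulr_gt0.
(* This threshold gives [C <= n^(1/200)], that is [C * r ^+ 4 <= 1] for the [r] chosen below. *)
exists c0, (Num.bound (C ^+ 200)); split=> // n hn l /andP[l2 ll0] kappa kpos sumk
  kp A AU hv.
have npos := coord_gt0 l2 kpos sumk.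
have n0 : 0 < n%:R :> R by rewrite ltr0n.
have n1 : 1 <= n%:R :> R by rewrite ler1n.
case: (lerP (vol R kappa A + c0 * (ln n%:R / n%:R))
   (expect_upper n kappa (fun kappa' => vol R kappa' (upper_shadow kappa' A)))).
  by left.
rewrite -ltrBlDl -/(expected_gain R kappa A);
  set Gamma := expected_gain R kappa A => hG.
right; apply: contrapT => hcorr.
pose eta : R := 1 / n%:R `^ (1 / 100).
have eta0 : 0 <= eta by rewrite divr_ge0// powR_ge0.
have hc (j : 'I_n) (c d : 'I_l) : (c < d)%N -> corr R kappa A j c d <= eta.
  move=> cd; case: (lerP eta (corr R kappa A j c d)) => [h|/ltW//].
  by case: hcorr; exists j, c, d.
have eps1 : eps <= 1 by move/andP: hv => [h1 h2]; lra.
have U0 : (0 < #|multislice n kappa|)%N.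
  rewrite lt0n; apply/eqP => U0; move: hv; rewrite /vol U0 invr0 mulr0.
  by move=> /andP[h _]; move: (lt_le_trans heps h); rewrite ltxx.
(* The correlation bound n^(-1/100) is r^8, and the influences are at most r^4. *)
pose r : R := n%:R `^ (- (1 / 800)).
have r0 : 0 < r by rewrite powR_gt0.
have rX k : r ^+ k = n%:R `^ (- (1 / 800) * k%:R) by rewrite -powR_mulrn ?ltW// powRrM.
have r1 : r <= 1.
  have e : - (1 / 800) <= 0 :> R by lra.
  by have := ler_powR n1 e; rewrite powRr0.
have etaE : eta = r ^+ 8.
  by rewrite rX /eta div1r -powRN; congr (_ `^ _); field.
have lnr : ln r = - (1 / 800) * ln n%:R by rewrite ln_powR.
have ln0 : 0 <= ln n%:R :> R by rewrite ln_ge0.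
have c01 : c0 <= 1.
  rewrite ler_pdivrMr ?mulr_gt0// mul1r.
  have : eps ^+ 2 <= 1 by rewrite expr_le1// ltW.
  lra.
have hlneta : ln n%:R / n%:R <= 2 * eta.
  apply: (le_trans (ln_le_powR_half n1)); rewrite ler_pM2l// /eta [leRHS]div1r -powRN.
  by apply: ler_powR => //; lra.
have hGeta : Gamma <= 2 * eta.
  apply: (le_trans (ltW hG)); apply: le_trans hlneta.
  by rewrite ler_piMl// divr_ge0// ltW.
have hCr : C * r ^+ 4 <= 1.
  have Cn : C ^+ 200 <= n%:R.
    apply: ltW; apply: lt_le_trans (archi_boundP _) _; first by rewrite exprn_ge0.
    by rewrite ler_nat.
  have C200 : C = (C ^+ 200) `^ (1 / 200).
    by rewrite -powR_mulrn// -powRrM (_ : 200%:R * _ = 1) ?powRr1//; field.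
  have : C <= n%:R `^ (1 / 200).
    by rewrite [leLHS]C200; apply: ge0_ler_powR;
      rewrite ?nnegrE ?exprn_ge0 ?divr_ge0 ?(ltW n0).
  rewrite rX (_ : _ * 4%:R = - (1 / 200)); last by field.
  rewrite powRN; have : 0 < n%:R `^ (1 / 200) :> R by rewrite powR_gt0.
  move: (n%:R `^ _) => w w0 h; rewrite ler_pdivrMr//.
  by apply: le_trans h _; rewrite ler_peMl// ltW.
have hI t : ip (multislice n kappa) (dswap t (fun u => (u \in A)%:R))
    (dswap t (fun u => (u \in A)%:R)) <= r ^+ 4 * #|multislice n kappa|%:R :> R.
  apply: (le_trans (influence_le_corr l2 hp kpos sumk kp AU U0 t eta0 hc)).
  rewrite -/Gamma mulrCA mulrC ler_wpM2r//.
  (* [C * eta = (C * r ^+ 4) * r ^+ 4]: half of the exponent in [eta = r ^+ 8] absorbs the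
     constant. *)
  apply: (@le_trans _ _ (C * eta)); last first.
    rewrite etaE (exprD r 4 4) mulrA ler_piMl// exprn_ge0 ?ltW//.
  rewrite /C -[leRHS]mulrA ler_pM ?mulr_ge0 ?sqr_ge0//.
  - have [G0 _ _] := expected_gain_ge R kpos AU U0
      (isT : (Ordinal (ltnW l2) < Ordinal l2)%N).
    by rewrite addr_ge0// !divr_ge0 ?sqr_ge0// ltW.
  - by rewrite ler_pM2l// ler_pXn2r ?nnegrE// ler_nat.
  have -> : (2 / p ^+ 2 / p + 1) * eta = 2 * eta / p ^+ 2 / p + eta by ring.
  by rewrite lerD2r ler_wpM2r ?invr_ge0 ?(ltW hp)// ler_wpM2r ?invr_ge0 ?sqr_ge0.
have hal : 4 * l%:R / p <= alpha%:R.
  apply: le_trans (ltW halpha); rewrite ler_wpM2r ?invr_ge0 ?(ltW hp)// ler_pM2l//.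
  by rewrite ler_nat.
(* The resulting lower bound on [Gamma] is exactly [c0 * (ln n / n)], against the strict inequality
   [hG]. *)
have := gain_ge l2 hp kpos sumk kp AU U0 r0 r1 hal hI hv (ltW heps).
rewrite -/Gamma lnr; apply/negP; rewrite -ltNge.
have -> : - 2 * (- (1 / 800) * ln n%:R) * eps ^+ 2 =
   36 * alpha%:R * n%:R * (c0 * (ln n%:R / n%:R)).
  by rewrite /c0; field; rewrite !gt_eqF.
by rewrite ltr_pM2l// !mulr_gt0.
Qed.
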